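(* Let $\mu\ge -\tfrac12$ and let $a_m,b_m,c_m,d_m,e_m\in\mathbb{R}$ ($m=1,2$) with $b_1,b_2\neq 0$. For every $f\in L^1_\mu(\mathbb{R}^2,\mathbb{H})$, one has $\mathbb{D}^{a,b,c}_{d,e,\mu}[f]\in C_0(\mathbb{R}^2,\mathbb{H})$ and $$\left\|\mathbb{D}^{a,b,c}_{d,e,\mu}[f]\right\|_{\infty,\mu}\le\frac{c_\mu^2}{|b_1b_2|^{\mu+1}}\,\|f\|_{1,\mu}.$$
   Context: $\mathbb{H}$ denotes Hamilton's quaternions with units $\mathbf{i},\mathbf{j},\mathbf{k}$, conjugation $\overline{q}$ and norm $|q|=\sqrt{q\overline{q}}$. Write $v=(v_1,v_2)$, $w=(w_1,w_2)\in\mathbb{R}^2$, $a=(a_1,a_2)$, and similarly for $b,c,d,e$. Measure and constant: $d\lambda_\mu(v)=|v_1|^{2\mu+1}|v_2|^{2\mu+1}\,dv_1\,dv_2$ on $\mathbb{R}^2$, and $c_\mu=\left(\int_{\mathbb{R}}e^{-x^2/2}|x|^{2\mu+1}dx\right)^{-1}$. $L^1_\mu(\mathbb{R}^2,\mathbb{H})$ is the space of measurable $f:\mathbb{R}^2\to\mathbb{H}$ with $\|f\|_{1,\mu}=\int_{\mathbb{R}^2}|f|\,d\lambda_\mu<\infty$; $\|f\|_{\infty,\mu}$ is the essential supremum of $|f|$. $C_0(\mathbb{R}^2,\mathbb{H})$ is the space of continuous $f:\mathbb{R}^2\to\mathbb{H}$ with $\lim_{|v|\to\infty}|f(v)|=0$.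 Dunkl kernel: $j_\mu(x)=\Gamma(\mu+1)\sum_{n\ge0}\frac{(-1)^n}{n!\,\Gamma(n+\mu+1)}\left(\frac{x}{2}\right)^{2n}$ and, for $\mathbf{q}\in\{\mathbf{i},\mathbf{j}\}$ and $x,y\in\mathbb{R}$, $E_\mu(\mathbf{q}x,y)=j_\mu(xy)+\frac{\mathbf{q}xy}{2(\mu+1)}j_{\mu+1}(xy)$. Two-sided quaternion quadratic-phase Dunkl transform (QQPDT), for $f\in L^1_\mu(\mathbb{R}^2,\mathbb{H})$: $$\mathbb{D}^{a,b,c}_{d,e,\mu}[f](w)=c_\mu^2\int_{\mathbb{R}^2}\Psi^{a_1,b_1,c_1}_{d_1,e_1,\mu}(w_1,v_1)\,f(v)\,\Psi^{a_2,b_2,c_2}_{d_2,e_2,\mu}(w_2,v_2)\,d\lambda_\mu(v),$$ with $\Psi^{a_1,b_1,c_1}_{d_1,e_1,\mu}(w_1,v_1)=\frac{E_\mu(-\mathbf{i}w_1/b_1,v_1)}{(\mathbf{i}b_1)^{\mu+1}}e^{-\mathbf{i}(a_1v_1^2+c_1w_1^2+d_1v_1+e_1w_1)}$ and $\Psi^{a_2,b_2,c_2}_{d_2,e_2,\mu}(w_2,v_2)=\frac{E_\mu(-\mathbf{j}w_2/b_2,v_2)}{(\mathbf{j}b_2)^{\mu+1}}e^{-\mathbf{j}(a_2v_2^2+c_2w_2^2+d_2v_2+e_2w_2)}$. For $\mathbf{q}\in\{\mathbf{i},\mathbf{j}\}$ and real $t\ne0$, $(\mathbf{q}t)^{\mu+1}=|t|^{\mu+1}e^{\mathbf{q}\,\mathrm{sgn}(t)(\mu+1)\pi/2}$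 (principal value in $\mathbb{R}+\mathbf{q}\mathbb{R}\cong\mathbb{C}$). *)

(* Defs.v *)
From HB Require Import structures.
From mathcomp Require Import all_boot all_order all_algebra.
From mathcomp Require Import all_classical all_reals all_analysis.
From mathcomp Require Import measurable_realfun ess_sup_inf.
From mathcomp Require Import ring lra.

Set Implicit Arguments.
Unset Strict Implicit.
Unset Printing Implicit Defensive.

Import Order.TTheory GRing.Theory Num.Theory.
Import numFieldNormedType.Exports.

Local Open Scope classical_set_scope.
Local Open Scope ring_scope.

Record quat (R : realType) :=
  Quat { qre : R; qim_i : R; qim_j : R; qim_k : R }.

Section QuaternionAlgebra.
Variable R : realType.
Local Notation H := (quat R).
Implicit Types p q r : H.

Let tuple_of_quat q := (qre q, qim_i q, qim_j q, qim_k q).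
Let quat_of_tuple (t : R * R * R * R) := Quat t.1.1.1 t.1.1.2 t.1.2 t.2.

Let tuple_of_quatK : cancel tuple_of_quat quat_of_tuple.
Proof. by case. Qed.

HB.instance Definition _ := Choice.copy H (can_type tuple_of_quatK).

Lemma quatP p q : qre p = qre q -> qim_i p = qim_i q ->
  qim_j p = qim_j q -> qim_k p = qim_k q -> p = q.
Proof. by case: p => ? ? ? ?; case: q => ? ? ? ? /= -> -> -> ->. Qed.

Definition qadd p q : H := Quat (qre p + qre q) (qim_i p + qim_i q)
  (qim_j p + qim_j q) (qim_k p + qim_k q).
Definition qopp p : H := Quat (- qre p) (- qim_i p) (- qim_j p) (- qim_k p).
Definition qscale (t : R) p : H :=
  Quat (t * qre p) (t * qim_i p) (t * qim_j p) (t * qim_k p).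

Lemma qaddA : associative qadd.
Proof. by move=> p q r; apply: quatP; rewrite /= addrA. Qed.
Lemma qaddC : commutative qadd.
Proof. by move=> p q; apply: quatP; rewrite /= addrC. Qed.
Lemma qadd0 : left_id (Quat 0 0 0 0) qadd.
Proof. by move=> p; apply: quatP; rewrite /= add0r. Qed.
Lemma qaddN : left_inverse (Quat 0 0 0 0) qopp qadd.
Proof. by move=> p; apply: quatP; rewrite /= addNr. Qed.

HB.instance Definition _ := GRing.isZmodule.Build H qaddA qaddC qadd0 qaddN.

Definition qmul p q : H := Quat
  (qre p * qre q - qim_i p * qim_i q - qim_j p * qim_j q - qim_k p * qim_k q)
  (qre p * qim_i q + qim_i p * qre q + qim_j p * qim_k q - qim_k p * qim_j q)
  (qre p * qim_j q - qim_i p * qim_k q + qim_j p * qre q + qim_k p * qim_i q)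
  (qre p * qim_k q + qim_i p * qim_j q - qim_j p * qim_i q + qim_k p * qre q).

Lemma qmulA : associative qmul.
Proof. by move=> p q r; apply: quatP => /=; ring. Qed.
Lemma qmul1l : left_id (Quat 1 0 0 0) qmul.
Proof. by move=> p; apply: quatP => /=; ring. Qed.
Lemma qmul1r : right_id (Quat 1 0 0 0) qmul.
Proof. by move=> p; apply: quatP => /=; ring. Qed.
Lemma qmulDl : left_distributive qmul +%R.
Proof. by move=> p q r; apply: quatP => /=; ring. Qed.
Lemma qmulDr : right_distributive qmul +%R.
Proof. by move=> p q r; apply: quatP => /=; ring. Qed.
Lemma qoner_neq0 : Quat 1 0 0 0 != 0 :> H.
Proof. by apply/eqP => -[/eqP]; rewrite oner_eq0. Qed.

HB.instance Definition _ := GRing.Zmodule_isNzRing.Build H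
  qmulA qmul1l qmul1r qmulDl qmulDr qoner_neq0.

Lemma qscaleA s t p : qscale s (qscale t p) = qscale (s * t) p.
Proof. by apply: quatP; rewrite /= mulrA. Qed.
Lemma qscale1 : left_id 1 qscale.
Proof. by move=> p; apply: quatP; rewrite /= mul1r. Qed.
Lemma qscaleDr : right_distributive qscale +%R.
Proof. by move=> t p q; apply: quatP; rewrite /= mulrDr. Qed.
Lemma qscaleDl p : {morph qscale^~ p : s t / s + t}.
Proof. by move=> s t; apply: quatP; rewrite /= mulrDl. Qed.

HB.instance Definition _ := GRing.Zmodule_isLmodule.Build R H
  qscaleA qscale1 qscaleDr qscaleDl.

Lemma qscaleAl (t : R) p q : t *: (p * q) = (t *: p) * q.
Proof. by apply: quatP => /=; ring. Qed.
HB.instance Definition _ := GRing.Lmodule_isLalgebra.Build R H qscaleAl.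
Lemma qscaleAr (t : R) p q : t *: (p * q) = p * (t *: q).
Proof. by apply: quatP => /=; ring. Qed.
HB.instance Definition _ := GRing.Lalgebra_isAlgebra.Build R H qscaleAr.

Definition qconj q : H := Quat (qre q) (- qim_i q) (- qim_j q) (- qim_k q).

Definition qnorm q : R := Num.sqrt (qre (q * qconj q)).

Lemma qre_mul_conj q : qre (q * qconj q) =
  qre q ^+ 2 + qim_i q ^+ 2 + qim_j q ^+ 2 + qim_k q ^+ 2.
Proof. by rewrite /=; ring. Qed.

Lemma qre_mul_conj_ge0 q : 0 <= qre (q * qconj q).
Proof. by rewrite qre_mul_conj !addr_ge0 ?sqr_ge0. Qed.

Lemma qnorm_triangle p q : qnorm (p + q) <= qnorm p + qnorm q.
Proof.
rewrite /qnorm.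
have := qre_mul_conj_ge0 p; have := qre_mul_conj_ge0 q.
have cauchy : (qre (p * qconj q)) ^+ 2 <=
    qre (p * qconj p) * qre (q * qconj q).
  rewrite !qre_mul_conj -subr_ge0.
  have -> : (qre p ^+ 2 + qim_i p ^+ 2 + qim_j p ^+ 2 + qim_k p ^+ 2) *
      (qre q ^+ 2 + qim_i q ^+ 2 + qim_j q ^+ 2 + qim_k q ^+ 2) -
      qre (p * qconj q) ^+ 2 =
      qim_i (p * qconj q) ^+ 2 + qim_j (p * qconj q) ^+ 2 +
      qim_k (p * qconj q) ^+ 2 by rewrite /=; ring.
  by rewrite !addr_ge0 ?sqr_ge0.
have -> : qre ((p + q) * qconj (p + q)) = qre (p * qconj p) +
    qre (p * qconj q) *+ 2 + qre (q * qconj q) by rewrite /= mulr2n; ring.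
move: cauchy; set P := qre (p * qconj p); set Q := qre (q * qconj q).
set C := qre (p * qconj q) => cauchy Q0 P0.
rewrite -ler_sqr ?nnegrE ?addr_ge0 ?sqrtr_ge0//.
have CPQ : C <= Num.sqrt P * Num.sqrt Q.
  rewrite -sqrtrM// (le_trans (ler_norm _))// -sqrtr_sqr.
  by rewrite ler_sqrt// mulr_ge0.
have PQC0 : 0 <= P + C *+ 2 + Q.
  have -> : P + C *+ 2 + Q = qre ((p + q) * qconj (p + q)).
    by rewrite /P /Q /C /= mulr2n; ring.
  exact: qre_mul_conj_ge0.
rewrite sqr_sqrtr// sqrrD !sqr_sqrtr//.
by rewrite lerD2r lerD2l lerMn2r.
Qed.

Lemma qnormZ (t : R) q : qnorm (t *: q) = `|t| * qnorm q.
Proof.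
rewrite /qnorm (_ : qre _ = t ^+ 2 * qre (q * qconj q)); last by rewrite /=; ring.
by rewrite sqrtrM ?sqr_ge0// sqrtr_sqr.
Qed.

Lemma qre_mul_conj_eq0 q : qre (q * qconj q) = 0 -> q = 0.
Proof.
rewrite qre_mul_conj => /eqP.
rewrite !paddr_eq0 ?addr_ge0 ?sqr_ge0// !sqrf_eq0.
by move=> /andP[/andP[/andP[/eqP ? /eqP ?] /eqP ?] /eqP ?]; exact: quatP.
Qed.

Lemma qnorm0_eq0 q : qnorm q = 0 -> q = 0.
Proof.
move=> /eqP; rewrite sqrtr_eq0 => q0; apply: qre_mul_conj_eq0.
by apply/eqP; rewrite eq_le q0 qre_mul_conj_ge0.
Qed.

Definition qinv q : H := (qre (q * qconj q))^-1 *: qconj q.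

Lemma qmulVq q : q != 0 -> qinv q * q = 1.
Proof.
move=> q0; rewrite /qinv -scalerAl.
have -> : qconj q * q = (qre (q * qconj q)) *: 1 by apply: quatP => /=; ring.
rewrite scalerA mulVf ?scale1r//.
by apply: contra_neq q0 => /qre_mul_conj_eq0.
Qed.

Lemma qmulqV q : q != 0 -> q * qinv q = 1.
Proof.
move=> q0; rewrite /qinv -scalerAr.
have {2}-> : q * qconj q = (qre (q * qconj q)) *: 1 by apply: quatP => /=; ring.
rewrite scalerA mulVf ?scale1r//.
by apply: contra_neq q0 => /qre_mul_conj_eq0.
Qed.

Lemma qunitP p q : q * p = 1 /\ p * q = 1 -> p != 0.
Proof.
move=> [_ pq]; apply/eqP => p0; move: pq; rewrite p0 mul0r => /eqP.
by rewrite eq_sym oner_eq0.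
Qed.

Lemma qinv_out : {in [predC [pred q : H | q != 0]], qinv =1 id}.
Proof.
move=> q; rewrite !inE negbK => /eqP ->.
by apply: quatP; rewrite /= ?oppr0 mulr0.
Qed.

HB.instance Definition _ := GRing.NzRing_hasMulInverse.Build H
  qmulVq qmulqV qunitP qinv_out.

HB.instance Definition _ := Lmodule_isNormed.Build R H
  qnorm_triangle qnormZ qnorm0_eq0.

HB.instance Definition _ :=
  Measurable.copy H (g_sigma_algebraType (@open H)).

Definition qi : H := Quat 0 1 0 0.
Definition qj : H := Quat 0 0 1 0.
Definition qk : H := Quat 0 0 0 1.

End QuaternionAlgebra.

Arguments qi {R}.
Arguments qj {R}.
Arguments qk {R}.

Section QuaternionIntegral.
Context {d} {T : measurableType d} {R : realType}.

Definition qintegral (m : {measure set T -> \bar R}) (f : T -> quat R) : quat R :=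
  Quat (\int[m]_x qre (f x)) (\int[m]_x qim_i (f x))
       (\int[m]_x qim_j (f x)) (\int[m]_x qim_k (f x)).

End QuaternionIntegral.

Section DunklMeasure.
Variable R : realType.
Implicit Type mu : R.

Local Notation plane := (measurableTypeR R * measurableTypeR R)%type.

Definition lebesgue2 : set plane -> \bar R :=
  (@lebesgue_measure R \x @lebesgue_measure R)%E.

(* The library's power satisfies 0 `^ 0 = 1, so the weight is identically 1
   for mu = -1/2. *)
Definition dunkl_weight mu (v : plane) : R :=
  `|v.1| `^ (2 * mu + 1) * `|v.2| `^ (2 * mu + 1).

Definition dunkl_measure mu (A : set plane) : \bar R :=
  (\int[lebesgue2]_(v in A) (dunkl_weight mu v)%:E)%E.

Lemma dunkl_weight_ge0 mu v : 0 <= dunkl_weight mu v.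
Proof. by rewrite mulr_ge0 ?powR_ge0. Qed.

Lemma measurable_dunkl_weight mu :
  measurable_fun [set: plane] (dunkl_weight mu).
Proof.
apply: measurable_funM => /=.
  apply: (measurableT_comp (measurable_powR _)).
  by apply: measurableT_comp => //; exact: measurable_fst.
apply: (measurableT_comp (measurable_powR _)).
by apply: measurableT_comp => //; exact: measurable_snd.
Qed.

Lemma dunkl_measure0 mu : dunkl_measure mu set0 = 0%E.
Proof. by rewrite /dunkl_measure integral_set0. Qed.

Lemma dunkl_measure_ge0 mu A : (0 <= dunkl_measure mu A)%E.
Proof. by apply: integral_ge0 => v _; rewrite lee_fin dunkl_weight_ge0. Qed.

Lemma dunkl_measure_sigma_additive mu : semi_sigma_additive (dunkl_measure mu).
Proof.
move=> /= F mF tF mUF; rewrite /dunkl_measure; apply: cvg_toP.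
  apply: ereal_nondecreasing_is_cvgn => m n mn.
  apply: lee_sum_nneg_natr => // k _ _; apply: integral_ge0 => /= x Fkx.
  by rewrite lee_fin dunkl_weight_ge0.
rewrite /lebesgue2 ge0_integral_bigcup//=.
- apply/measurable_funTS/measurableT_comp => //.
  exact: measurable_dunkl_weight.
- by move=> x _; rewrite lee_fin dunkl_weight_ge0.
Qed.

HB.instance Definition _ mu := isMeasure.Build _ _ _ (dunkl_measure mu)
  (dunkl_measure0 mu) (dunkl_measure_ge0 mu) (@dunkl_measure_sigma_additive mu).

Definition dunkl_const mu : R :=
  (\int[@lebesgue_measure R]_x (expR (- (x ^+ 2 / 2)) * `|x| `^ (2 * mu + 1)))^-1.

Definition L1norm mu (f : plane -> quat R) : \bar R :=
  (\int[dunkl_measure mu]_v (`|f v|)%:E)%E.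

Definition in_L1 mu (f : plane -> quat R) : Prop :=
  measurable_fun setT f /\ (L1norm mu f < +oo)%E.

Definition Linfnorm mu (f : plane -> quat R) : \bar R :=
  ess_sup (dunkl_measure mu) (fun v => (`|f v|)%:E).

(* The library's norm on R * R is the max norm. *)
Definition euclid_norm (v : R * R) : R := Num.sqrt (v.1 ^+ 2 + v.2 ^+ 2).

Definition in_C0 (f : R * R -> quat R) : Prop :=
  continuous f /\
  forall eps : R, 0 < eps ->
    exists M : R, forall v, M < euclid_norm v -> `|f v| < eps.

End DunklMeasure.

Section DunklKernel.
Variable R : realType.
Implicit Types mu x y t theta : R.

(* Euler's integral; the library has no Gamma function. *)
Definition Gamma x : R :=
  \int[@lebesgue_measure R]_(t in `]0, +oo[) (t `^ (x - 1) * expR (- t)).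

Definition bessel_j mu x : R := Gamma (mu + 1) *
  limn (series (fun n : nat =>
    (-1) ^+ n / (n`!%:R * Gamma (n%:R + mu + 1)) * (x / 2) ^+ (2 * n))).

(* dunkl_E mu q x y is E_mu(q x, y) for an imaginary unit q. *)
Definition dunkl_E mu (q : quat R) x y : quat R :=
  (bessel_j mu (x * y))%:A +
  (x * y / (2 * (mu + 1)) * bessel_j (mu + 1) (x * y)) *: q.

(* e^(q theta) in R + q R, for an imaginary unit q. *)
Definition qcis (q : quat R) theta : quat R :=
  (cos theta)%:A + (sin theta) *: q.

(* Principal value of (q t)^s in R + q R, for an imaginary unit q and t != 0. *)
Definition qpow (q : quat R) t (s : R) : quat R :=
  `|t| `^ s *: qcis q (Num.sg t * s * pi / 2).

(* The quotient is unambiguous: both terms lie in the commutative field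
   R + q R. *)
Definition qqpdt_kernel mu (q : quat R) (a b c d e w v : R) : quat R :=
  dunkl_E mu q (- w / b) v / qpow q b (mu + 1) *
  qcis q (- (a * v ^+ 2 + c * w ^+ 2 + d * v + e * w)).

Definition qqpdt mu (a b c d e : R * R)
    (f : measurableTypeR R * measurableTypeR R -> quat R)
    (w : R * R) : quat R :=
  dunkl_const mu ^+ 2 *: qintegral (dunkl_measure mu) (fun v =>
    qqpdt_kernel mu qi a.1 b.1 c.1 d.1 e.1 w.1 v.1 * f v *
    qqpdt_kernel mu qj a.2 b.2 c.2 d.2 e.2 w.2 v.2).

End DunklKernel.

(* Main.v *)
Require Import Defs.
From HB Require Import structures.
From mathcomp Require Import all_boot all_order all_algebra.
From mathcomp Require Import all_classical all_reals all_analysis.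
From mathcomp Require Import measurable_realfun ess_sup_inf.
From mathcomp Require Import ring lra.
Import Order.TTheory GRing.Theory Num.Theory.
Import numFieldNormedType.Exports.
Local Open Scope classical_set_scope.
Local Open Scope ring_scope.

(** Write [C x] for [bessel_j mu x] and [S x] for
[x * bessel_j (mu + 1) x / (2 * (mu + 1))], so that the Dunkl kernel
[E_mu(q x, y)] is [C (x * y) + S (x * y) q].  Everything rests on the system
[C' = - S], [S' = C - (2 mu + 1) S / x], read off the power series of the
confluent function 0F1.

- Boundedness.  For [x > 0], the derivative of [C ^ 2 + S ^ 2] is
  [- 2 (2 mu + 1) S ^ 2 / x], nonpositive as soon as [mu >= - 1 / 2].  Hence
  [C ^ 2 + S ^ 2 <= 1] ([dunkl_cos2Dsin2_le1]): the kernel has norm at most 1,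
  without any integral representation.

- Oscillation.  For [mu = - 1 / 2] the kernel does not decay at infinity, so
  pointwise decay cannot be the reason why the transform vanishes there.  What
  holds for every [mu] is that [S] is the derivative of the bounded function
  [- C], and that [C] is the sum of the derivative of the bounded function [S]
  and of [(2 mu + 1) S / x], which tends to 0 at infinity.  So the integral of
  [S (lam x)] or [C (lam x)] over a fixed interval tends to 0 when [lam] tends
  to infinity.  A family of uniformly bounded functions whose integrals over
  the members of a generating pi-system tend to 0 also has vanishing integrals
  against every integrable function ([weak_null_dynkin],
  [weak_null_exhaust]).  This is applied to intervals of the line, then to
  rectangles of the plane, where it suffices that one of the two factors
  oscillates faster and faster ([weak_null_tensor]); it gives the
  Riemann-Lebesgue lemma in the plane ([planar_transform_C0]).  The continuity
  of the transform is dominated convergence.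

- Phases.  All values of the first kernel lie in the commutative field
  [R + i R], those of the second in [R + j R].  The chirps in [v] can therefore
  be moved next to [f], whose norm they do not change, and the phases in [w]
  can be moved out of the integral, where they are continuous and of norm 1
  ([qqpdtE]).  What remains is the scalar
  [c_mu ^ 2 / |b_1 b_2| ^ (mu + 1)] times a two-sided Dunkl transform, whose
  kernel expands into four products of the real functions [C] and [S].  The
  norm estimate is then the triangle inequality for quaternion integrals
  ([norm_qintegral_le]). *)

Set Implicit Arguments.
Unset Strict Implicit.
Unset Printing Implicit Defensive.

(** * The Gamma function *)

Section Gamma.
Context {R : realType}.
Local Notation leb := (@lebesgue_measure R).
Implicit Types (x t : R) (n : nat).

Lemma integral_derive (F f : R -> R) (a b : R) : a < b ->
  (forall x, a <= x <= b -> is_derive x 1 F (f x)) ->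
  (forall x, a <= x <= b -> {for x, continuous f}) ->
  (\int[leb]_(x in `[a, b]) (f x)%:E = (F b - F a)%:E)%E.
Proof.
move=> ab dF cf; rewrite EFinB.
have cF x : a <= x <= b -> {for x, continuous F}.
  move=> /dF dFx; apply: differentiable_continuous.
  by apply/derivable1_diffP; exact: ex_derive.
apply: continuous_FTC2 => //.
- apply: continuous_in_subspaceT => x.
  by rewrite inE/= in_itv/=; exact: cf.
- split.
  + by move=> x; rewrite in_itv/= => /andP[/ltW ax /ltW xb];
      have ? := dF x (introT andP (conj ax xb)); exact: ex_derive.
  + by apply: cvg_at_right_filter; apply: cF; rewrite lexx ltW.
  + by apply: cvg_at_left_filter; apply: cF; rewrite lexx ltW.
- move=> x; rewrite in_itv/= => /andP[/ltW ax /ltW xb].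
  have ? := dF x (introT andP (conj ax xb)).
  by rewrite derive1E derive_val.
Qed.

(** Euler's integral with values in the extended reals: the functional equation
can then be proved before convergence is known. *)
Definition Gamma_integral x : \bar R :=
  (\int[leb]_(t in `]0%R, +oo[) (t `^ (x - 1) * expR (- t))%:E)%E.

(* The offset 2 keeps the left endpoint strictly below the right one. *)
Let exhaustion n : set R := [set` `[n.+2%:R^-1, n.+2%:R] ].

Let bigcup_exhaustion : \bigcup_n exhaustion n = [set` `]0, +oo[ ].
Proof.
apply/seteqP; split => [t [n _]|t]; rewrite /exhaustion /= !in_itv/= andbT.
  by move=> /andP[+ _]; apply: lt_le_trans; rewrite invr_gt0.
move=> t0; exists (Num.truncn t + Num.truncn t^-1)%N => //=.
rewrite in_itv/=; apply/andP; split.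
  rewrite -[leRHS]invrK lef_pV2 ?posrE ?invr_gt0//.
  rewrite (le_trans (ltW (truncnS_gt _)))// ler_nat.
  by rewrite ltnS leqW// leq_addl.
rewrite (le_trans (ltW (truncnS_gt _)))// ler_nat.
by rewrite ltnS leqW// leq_addr.
Qed.

Let measurable_exhaustion n :
  measurable (exhaustion n : set (measurableTypeR R)).
Proof. exact: measurable_itv. Qed.

Let nd_exhaustion : nondecreasing_seq exhaustion.
Proof.
move=> m n mn; rewrite subsetEset => t; rewrite /exhaustion/= !in_itv/=.
move=> /andP[mt tm]; apply/andP; split.
  by rewrite (le_trans _ mt)// lef_pV2 ?posrE// ler_nat !ltnS.
by rewrite (le_trans tm)// ler_nat !ltnS.
Qed.

Lemma continuous_Gamma_integrand x t : 0 < t ->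
  {for t, continuous (fun t => t `^ x * expR (- t))}.
Proof.
move=> t0; have cpow : {for t, continuous (fun t => t `^ x)}.
  apply: differentiable_continuous; apply/derivable1_diffP.
  exact: (@ex_derive _ _ _ _ _ _ _ (is_derive1_powR x t0)).
have cexp : {for t, continuous (fun t => expR (- t))}.
  by apply: continuous_comp; [exact: opp_continuous|exact: continuous_expR].
exact: cvgM cpow cexp.
Qed.

Let measurable_integrand x :
  measurable_fun [set: R] (fun t => (t `^ x * expR (- t))%:E).
Proof.
apply/measurable_EFinP; apply: measurable_funM; first exact: measurable_powR.
by apply: measurableT_comp => //; exact: measurableT_comp.
Qed.

Let cvg_exhaustion x :
  (\int[leb]_(t in exhaustion n) (t `^ x * expR (- t))%:E)%E @[n --> \oo]
  --> Gamma_integral (x + 1).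
Proof.
rewrite /Gamma_integral addrK -bigcup_exhaustion.
apply: ge0_nondecreasing_set_cvg_integral => //.
- by move=> n; exact: measurable_funTS (measurable_integrand _).
- by move=> n t _; rewrite lee_fin mulr_ge0 ?powR_ge0 ?expR_ge0.
Qed.

(* The boundary terms of the integration by parts vanish: at 0 because [x > 0],
   at infinity because [exp t >= t ^ (m + 1) / (m + 1)!] for an integer
   [m >= x]. *)
Let boundary_cvg0 x : 0 < x ->
  (fun n => n.+2%:R^-1 `^ x * expR (- n.+2%:R^-1)
    - n.+2%:R `^ x * expR (- n.+2%:R)) @ \oo --> (0 : R).
Proof.
move=> x0.
have inv0 : (fun n => n.+2%:R^-1 : R) @ \oo --> 0^'+.
  move=> P [e /= e0 eP]; change (\forall n \near \oo, P n.+2%:R^-1).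
  near=> n; apply: eP => /=; last by rewrite invr_gt0.
  rewrite sub0r normrN ger0_norm; last by rewrite invr_ge0.
  rewrite (@le_lt_trans _ _ n.+1%:R^-1)//; first by rewrite lef_pV2 ?posrE// ler_nat.
  by near: n; exact: near_infty_natSinv_lt (PosNum e0).
have left0 : (fun n => n.+2%:R^-1 `^ x) @ \oo --> (0 : R).
  exact: cvg_comp inv0 (powR_cvg0 x0).
rewrite -[X in _ --> X]subr0; apply: cvgB.
  apply: (@squeeze_cvgr _ _ _ _ (cst 0) (fun n => n.+2%:R^-1 `^ x)) => //.
    apply: nearW => n; rewrite mulr_ge0 ?powR_ge0 ?expR_ge0//=.
    by rewrite ler_piMr ?powR_ge0// -expR0 ler_expR oppr_le0.
  exact: cvg_cst.
have [m xm] : exists m : nat, x <= m%:R.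
  by exists (Num.truncn x).+1; rewrite ltW// truncnS_gt.
apply: (@squeeze_cvgr _ _ _ _ (cst 0) (fun n => m.+1`!%:R * n.+2%:R^-1)).
- apply: nearW => n; rewrite mulr_ge0 ?powR_ge0 ?expR_ge0//=.
  rewrite expRN ler_pdivrMr ?expR_gt0// mulrAC ler_pdivlMr//.
  have : n.+2%:R ^+ m.+1 / m.+1`!%:R <= expR n.+2%:R :> R.
    by apply: (@le_trans _ _ (1 + n.+2%:R ^+ m.+1 / m.+1`!%:R));
      [rewrite lerDr|exact: expR_ge1Dxn].
  rewrite ler_pdivrMr ?ltr0n ?fact_gt0// mulrC; apply: le_trans.
  rewrite exprSr ler_pM2r// -powR_mulrn//.
  by rewrite ler_powR// ler1n.
- exact: cvg_cst.
- rewrite -[X in _ --> X](mulr0 m.+1`!%:R); apply: cvgMr.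
  exact: cvg_trans inv0 (@cvg_within _ _ _ _).
Unshelve. all: by end_near. Qed.

(** Integration by parts on the exhausting segments.  The passage to the limit
is monotone convergence on both sides, so that both sides may be infinite. *)
Lemma Gamma_integralS x : 0 < x ->
  Gamma_integral (x + 1) = (x%:E * Gamma_integral x)%E.
Proof.
move=> x0; 
have parts n : (\int[leb]_(t in exhaustion n) (t `^ x * expR (- t))%:E =
   (n.+2%:R^-1 `^ x * expR (- n.+2%:R^-1) - n.+2%:R `^ x * expR (- n.+2%:R))%:E
   + x%:E * \int[leb]_(t in exhaustion n) (t `^ (x - 1) * expR (- t))%:E)%E.
  have lt_ends : n.+2%:R^-1 < n.+2%:R :> R.
    by rewrite (@lt_trans _ _ 1)// ?invf_lt1// ltr1n.
  have pos t : n.+2%:R^-1 <= t <= n.+2%:R -> 0 < t.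
    by move=> /andP[+ _]; apply: lt_le_trans; rewrite invr_gt0.
  have dF t : n.+2%:R^-1 <= t <= n.+2%:R -> is_derive t 1
      (fun t => - (t `^ x * expR (- t)))
      (t `^ x * expR (- t) - x * (t `^ (x - 1) * expR (- t))).
    move=> /pos t0; have ? := is_derive1_powR x t0.
    by apply: is_derive_eq; rewrite /GRing.scale/=; ring.
  have cf t : n.+2%:R^-1 <= t <= n.+2%:R -> {for t, continuous
      (fun t => t `^ x * expR (- t) - x * (t `^ (x - 1) * expR (- t)))}.
    move=> /pos t0; apply: cvgB; first exact: continuous_Gamma_integrand.
    by apply: cvgMr; exact: continuous_Gamma_integrand.
  have int_pow y : leb.-integrable (exhaustion n) (fun t => (t `^ y * expR (- t))%:E).
    apply: continuous_compact_integrable; first exact: segment_compact.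
    apply: continuous_in_subspaceT => t; rewrite inE /exhaustion/= in_itv/= => /pos.
    exact: continuous_Gamma_integrand.
  have : (\int[leb]_(t in exhaustion n) (t `^ x * expR (- t)
       - x * (t `^ (x - 1) * expR (- t)))%:E = _)%E := integral_derive lt_ends dF cf.
  under eq_integral do rewrite EFinB (EFinM x).
  rewrite (integralB (measurable_exhaustion n) (int_pow x)); last first.
    by have := integrableZl (measurable_exhaustion n) x (int_pow (x - 1)); apply.
  rewrite (integralZl (measurable_exhaustion n) (int_pow (x - 1)) x).
  have := integrable_fin_num (measurable_exhaustion n) (int_pow (x - 1)).
  have := integrable_fin_num (measurable_exhaustion n) (int_pow x).
  move=> /fineK <- /fineK <-; rewrite -!EFinM -!EFinB -EFinD => -[h].
  set V := fine (\int[leb]_(t in exhaustion n) (t `^ (x - 1) * expR (- t))%:E)%E.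
  by congr EFin; rewrite -[LHS](subrK (x * V)) h; ring.
suff : (\int[leb]_(t in exhaustion n) (t `^ x * expR (- t))%:E)%E @[n --> \oo]
    --> (x%:E * Gamma_integral x)%E.
  by move=> h; have := cvg_unique _ (@cvg_exhaustion x) h; apply.
rewrite (funext parts) -[X in _ --> X]add0e; apply: cvgeD => //.
- by apply: cvg_EFin; [exact: nearW|exact: boundary_cvg0].
- apply: cvgeZl => //; have := @cvg_exhaustion (x - 1); rewrite subrK; apply.
Qed.

(** The functional equation does most of the work: it gives [Gamma (n + 1) = n!],
finite, and [t ^ y <= 1 + t ^ m] for [0 <= y <= m] bounds the integral at
[y + 1] by those at [1] and [m + 1].  For [0 < x < 1] the integrand is singular
at 0, and the functional equation is used once more, backwards. *)
Lemma Gamma_integral_fin_num x : 0 < x -> Gamma_integral x \is a fin_num.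
Proof.
have Gamma1 : Gamma_integral 1 = 1%E.
  rewrite /Gamma_integral integral_itv_obnd_cbnd; last first.
    by apply: measurable_funTS; exact: measurable_integrand.
  under eq_integral do rewrite subrr powRr0 mul1r.
  rewrite (@ge0_continuous_FTC2y _ _ (fun x => - (expR (- x))) _ 0)//.
  - by rewrite oppr0 expR0 EFinN oppeK add0e.
  - apply: continuous_subspaceT => t.
    by apply: continuous_comp; [exact: opp_continuous|exact: continuous_expR].
  - by rewrite -oppr0; apply: cvgN; exact: cvgr_expR.
  - apply: cvgN; apply: cvg_at_right_filter.
    by apply: continuous_comp; [exact: opp_continuous|exact: continuous_expR].
  - by move=> t _; rewrite derive1E derive_val; ring.
have Gamma_nat n : Gamma_integral n.+1%:R = n`!%:R%:E.
  elim: n => // n IH; rewrite -natr1 Gamma_integralS// IH -EFinM -natrM.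
  by rewrite factS.
have Gamma_ge0 y : (0 <= Gamma_integral y)%E.
  by apply: integral_ge0 => t _; rewrite lee_fin mulr_ge0 ?powR_ge0 ?expR_ge0.
have Gamma_fin1 y : 0 <= y -> Gamma_integral (y + 1) \is a fin_num.
  move=> y0; rewrite ge0_fin_numE//.
  have [m ym] : exists m : nat, y <= m%:R.
    by exists (Num.truncn y).+1; rewrite ltW// truncnS_gt.
  apply: (@le_lt_trans _ _ (Gamma_integral 1 + Gamma_integral m.+1%:R)%E); last first.
    by rewrite Gamma1 Gamma_nat ltry.
  rewrite /Gamma_integral -ge0_integralD//; last first.
  - by apply: measurable_funTS; exact: measurable_integrand.
  - by move=> t _; rewrite lee_fin mulr_ge0 ?powR_ge0 ?expR_ge0.
  - by apply: measurable_funTS; exact: measurable_integrand.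
  - by move=> t _; rewrite lee_fin mulr_ge0 ?powR_ge0 ?expR_ge0.
  apply: ge0_le_integral => //.
  - by move=> t _; rewrite lee_fin mulr_ge0 ?powR_ge0 ?expR_ge0.
  - by apply: measurable_funTS; exact: measurable_integrand.
  - by apply: emeasurable_funD; apply: measurable_funTS; exact: measurable_integrand.
  - move=> t; rewrite /= in_itv/= andbT => t0.
    rewrite -EFinD lee_fin -mulrDl ler_wpM2r ?expR_ge0// addrK subrr powRr0.
    rewrite -natr1 addrK; have [t1|/ltW t1] := leP 1 t.
      by rewrite (le_trans (ler_powR t1 ym))// lerDr.
    rewrite (@le_trans _ _ 1)//; last by rewrite lerDl powR_ge0.
    by rewrite -(powRr0 t) ger_powR// t0.
move=> x0; have := Gamma_fin1 x (ltW x0); rewrite Gamma_integralS//.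
rewrite !ge0_fin_numE// ?mule_ge0// ?lee_fin ?ltW//.
by move: (Gamma_ge0 x); case: (Gamma_integral x) => [r _ _||//];
  [exact: ltry|rewrite gt0_muley].
Qed.

Lemma GammaE x : Gamma x = fine (Gamma_integral x).
Proof. by []. Qed.

Lemma GammaS x : 0 < x -> Gamma (x + 1) = x * Gamma x.
Proof.
move=> x0; rewrite !GammaE Gamma_integralS// fineM//.
exact: Gamma_integral_fin_num.
Qed.

(** On the segment from 1 to 2 the integrand is at least [exp (- 2) / 2]. *)
Lemma Gamma_gt0 x : 0 < x -> 0 < Gamma x.
Proof.
move=> x0; have Gx := Gamma_integral_fin_num x0.
suff : ((expR (- 2) / 2)%:E <= Gamma_integral x)%E.
  by rewrite GammaE -(fineK Gx) lee_fin; apply: lt_le_trans; rewrite divr_gt0 ?expR_gt0.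
have -> : (expR (- 2) / 2)%:E = (\int[leb]_(t in [set` `[1%R, 2%R] ]) (expR (- 2) / 2)%:E)%E.
  rewrite integral_cst//= lebesgue_measure_itv/= lte_fin ltr1n -EFinB -EFinM.
  by congr EFin; ring.
apply: (@le_trans _ _ (\int[leb]_(t in [set` `[1%R, 2%R] ]) (t `^ (x - 1) * expR (- t))%:E)%E).
  apply: ge0_le_integral => //.
  - by apply: measurable_funTS; exact: measurable_integrand.
  - move=> t; rewrite /= in_itv/= => /andP[t1 t2].
    rewrite lee_fin mulrC; apply: ler_pM; rewrite ?expR_ge0//; last first.
      by rewrite ler_expR lerN2.
    rewrite (@le_trans _ _ (t `^ (- 1)))//; last by rewrite ler_powR// lerDr ltW.
    by rewrite powR_inv1 ?(le_trans _ t1)// lef_pV2 ?posrE// (lt_le_trans _ t1).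
apply: ge0_subset_integral => //.
- by apply: measurable_funTS; exact: measurable_integrand.
- by move=> t _; rewrite lee_fin mulr_ge0 ?powR_ge0 ?expR_ge0.
- by move=> t; rewrite /= !in_itv/= andbT => /andP[t1 _]; exact: lt_le_trans t1.
Qed.

End Gamma.

(** * The confluent function 0F1 *)

Section Hypergeometric.
Context {R : realType}.
Implicit Types (s z x : R) (n : nat).

Definition pochhammer s n : R := \prod_(k < n) (s + k%:R).

Lemma pochhammerS s n : pochhammer s n.+1 = pochhammer s n * (s + n%:R).
Proof. by rewrite /pochhammer big_ord_recr. Qed.

Lemma pochhammerSl s n : pochhammer s n.+1 = s * pochhammer (s + 1) n.
Proof.
rewrite /pochhammer big_ord_recl/= addr0; congr (_ * _).
by apply: eq_bigr => i _; rewrite /bump/= natrD addrA.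
Qed.

(** This crude bound replaces all growth estimates: it makes the series of
[hyp01] converge everywhere, by comparison with twice an exponential
series. *)
Lemma pochhammer_ge s n : 2^-1 <= s -> 2^-1 <= pochhammer s n.
Proof.
move=> s2; case: n => [|n]; first by rewrite /pochhammer big_ord0; lra.
elim: n => [|n IH]; first by rewrite pochhammerSl /pochhammer big_ord0 mulr1.
rewrite pochhammerS (le_trans IH)// ler_peMr ?(le_trans _ IH)//.
have : 1 <= n.+1%:R :> R by rewrite ler1n.
by move=> ?; lra.
Qed.

Lemma pochhammer_gt0 s n : 2^-1 <= s -> 0 < pochhammer s n.
Proof. by move=> /(pochhammer_ge n); apply: lt_le_trans. Qed.

Lemma Gamma_addn s n : 0 < s -> Gamma (n%:R + s) = pochhammer s n * Gamma s.
Proof.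
move=> s0; elim: n => [|n IH]; first by rewrite /pochhammer big_ord0 add0r mul1r.
rewrite -natr1 addrAC GammaS ?IH ?pochhammerS; last by rewrite ltr_wpDl.
by ring.
Qed.

Definition hyp01_coef s n : R := (-1) ^+ n / (n`!%:R * pochhammer s n).

(** [hyp01 s z] is 0F1([s]; [- z]). *)
Definition hyp01 s z : R := limn (pseries (hyp01_coef s) z).

Lemma hyp01_coef_diffs s : 2^-1 <= s ->
  pseries_diffs (hyp01_coef s) = - s^-1 *: hyp01_coef (s + 1).
Proof.
move=> s2; apply/funext => n; rewrite /pseries_diffs /hyp01_coef/=.
have s0 : s != 0 by rewrite gt_eqF// (lt_le_trans _ s2).
have p0 : pochhammer (s + 1) n != 0 by rewrite gt_eqF// pochhammer_gt0//; lra.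
rewrite pochhammerSl factS natrM exprS /GRing.scale/=.
have f0 : n`!%:R != 0 :> R by rewrite pnatr_eq0 -lt0n fact_gt0.
have n0 : n.+1%:R != 0 :> R by rewrite pnatr_eq0.
rewrite /GRing.scale/=; field.
by rewrite p0 f0 s0 nat1r n0.
Qed.

Lemma is_cvg_hyp01 s z : 2^-1 <= s -> cvgn (pseries (hyp01_coef s) z).
Proof.
move=> s2; apply: normed_cvg.
apply: (@series_le_cvg _ _ (2 *: exp_coeff `|z|)) => [n|n|n|].
- exact: normr_ge0.
- by apply: mulr_ge0 => //; exact: exp_coeff_ge0.
- rewrite /= normrM normrX normrM normrX normrN1 expr1n mul1r normfV.
  rewrite (@ger0_norm _ (_ * _)); last by rewrite mulr_ge0// ltW// pochhammer_gt0.
  rewrite invfM /exp_coeff scalrfctE /GRing.scale/=.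
  rewrite [leRHS](_ : _ = n`!%:R^-1 * 2 * `|z| ^+ n); last by ring.
  rewrite ler_wpM2r ?exprn_ge0// ler_wpM2l ?invr_ge0//.
  by rewrite -[leRHS]invrK lef_pV2 ?posrE ?pochhammer_gt0// pochhammer_ge.
- by apply: is_cvg_seriesZ; exact: is_cvg_series_exp_coeff.
Qed.

Lemma pseriesZ (c : R^nat) (k z : R) : pseries (k *: c) z = k *: pseries c z.
Proof.
rewrite /pseries -seriesZ; congr series; apply/funext => n.
by rewrite !scalrfctE /GRing.scale/= mulrA.
Qed.

Lemma is_derive_hyp01 s z : 2^-1 <= s ->
  is_derive z 1 (hyp01 s) (- s^-1 * hyp01 (s + 1) z).
Proof.
move=> s2; have s12 : 2^-1 <= s + 1 by lra.
have s22 : 2^-1 <= s + 1 + 1 by lra.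
have zK : `|z| < `| `|z| + 1| by rewrite [ltRHS]ger0_norm ?addr_ge0// ltrDl.
have := @pseries_snd_diffs _ (hyp01_coef s) (`|z| + 1) z.
rewrite !hyp01_coef_diffs//.
have -> : pseries_diffs (- s^-1 *: hyp01_coef (s + 1)) =
    (- s^-1 * - (s + 1)^-1) *: hyp01_coef (s + 1 + 1).
  rewrite -scalerA -(hyp01_coef_diffs s12); apply/funext => n.
  by rewrite /pseries_diffs /GRing.scale/= /GRing.scale/=; ring.
rewrite !pseriesZ => /(_ (@is_cvg_hyp01 _ _ s2)) d.
have {}d := d _ _ zK; apply: is_derive_eq; first apply: d.
- by apply: is_cvgZr; exact: is_cvg_hyp01.
- by apply: is_cvgZr; exact: is_cvg_hyp01.
by apply: cvg_lim => //; apply: cvgZr; exact: is_cvg_hyp01.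
Qed.

(** Up to the factor in front of it, the third series, shifted by one index, is
the termwise difference of the other two. *)
Lemma hyp01_contiguous s z : 2^-1 <= s ->
  hyp01 s z = hyp01 (s + 1) z - z / (s * (s + 1)) * hyp01 (s + 2) z.
Proof.
move=> s2; have s12 : 2^-1 <= s + 1 by lra.
have s22 : 2^-1 <= s + 2 by lra.
apply: cvg_lim => //; rewrite -cvg_shiftS/=.
have E n : pseries (hyp01_coef s) z n.+1 = pseries (hyp01_coef (s + 1)) z n.+1
    - z / (s * (s + 1)) * pseries (hyp01_coef (s + 2)) z n.
  rewrite /pseries /series/= !big_nat_recl//=.
  rewrite {1 3}/hyp01_coef /pochhammer !big_ord0 -addrA; congr (_ + _).
  rewrite mulr_sumr -sumrB; apply: eq_bigr => k _.
  have s0 : s != 0 by rewrite gt_eqF//; lra.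
  have s1 : s + 1 != 0 by rewrite gt_eqF//; lra.
  have sk : s + k.+1%:R != 0 by rewrite gt_eqF// ltr_wpDr//; lra.
  have f0 : k`!%:R != 0 :> R by rewrite pnatr_eq0 -lt0n fact_gt0.
  have k0 : 1 + k%:R != 0 :> R by rewrite nat1r pnatr_eq0.
  have p0 : pochhammer (s + 2) k != 0 by rewrite gt_eqF// pochhammer_gt0.
  have p1 : pochhammer (s + 1) k.+1 = (s + 1) * pochhammer (s + 2) k.
    by rewrite pochhammerSl -addrA.
  have -> : hyp01_coef s k.+1 = (-1) ^+ k.+1 * (s + k.+1%:R)
      / (k.+1`!%:R * (s * ((s + 1) * pochhammer (s + 2) k))).
    rewrite -p1 -pochhammerSl pochhammerS mulrA -mulf_div divff// mulr1.
    by [].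
  rewrite /hyp01_coef p1 factS natrM !exprS; field.
  by rewrite p0 f0 s0 s1 k0.
rewrite (funext E); apply: cvgB.
  by rewrite (cvg_shiftS (pseries (hyp01_coef (s + 1)) z)); exact: is_cvg_hyp01.
by apply: cvgMr; exact: is_cvg_hyp01.
Qed.

Lemma hyp01_0 s : hyp01 s 0 = 1.
Proof.
apply: cvg_lim => //; rewrite -cvg_shiftS/=.
rewrite [X in X @ _ --> _](_ : _ = cst 1); first exact: cvg_cst.
apply/funext => n; rewrite /pseries /series/= big_nat_recl//= big1.
  by rewrite /hyp01_coef /pochhammer big_ord0 !expr0 !mulr1 divr1 addr0.
by move=> i _; rewrite exprS mul0r mulr0.
Qed.

End Hypergeometric.

(** * The real components of the Dunkl kernel *)

Section DunklKernelReal.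
Context {R : realType}.
Variable mu : R.
Hypothesis mu_ge : - 2^-1 <= mu.
Implicit Types (x : R) (n : nat).

Let mu1 : 2^-1 <= mu + 1. Proof. by have := mu_ge; lra. Qed.

Let mu1_neq0 : mu + 1 != 0.
Proof. by rewrite gt_eqF//; have := mu_ge; lra. Qed.

(** The Gamma factors of the series cancel by [Gamma_addn], up to a quotient
[Gamma (nu + 1) / Gamma (nu + 1)], which is 1 by positivity of Gamma. *)
Lemma bessel_jE (nu : R) x : 2^-1 <= nu + 1 ->
  bessel_j nu x = hyp01 (nu + 1) ((x / 2) ^+ 2).
Proof.
move=> nu1; have nu0 : 0 < nu + 1 by lra.
have G0 := Gamma_gt0 nu0; rewrite /bessel_j.
rewrite (_ : (fun n : nat => _) = (Gamma (nu + 1))^-1 *: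
    (fun n => hyp01_coef (nu + 1) n * ((x / 2) ^+ 2) ^+ n)).
  rewrite lim_seriesZ; last exact: is_cvg_hyp01.
  by rewrite /GRing.scale/= mulrA divff ?mul1r// gt_eqF.
apply/funext => n; rewrite /hyp01_coef -addrA Gamma_addn// scalrfctE exprM.
rewrite /GRing.scale/= invfM; set e := (_ ^+ _) ^+ _.
by rewrite !invfM; ring.
Qed.

(** For [mu = - 1 / 2] these are [cos x], [sin x / x] and [sin x]. *)
Definition dunkl_cos x : R := bessel_j mu x.
Definition dunkl_sinc x : R := bessel_j (mu + 1) x / (2 * (mu + 1)).
Definition dunkl_sin x : R := x * dunkl_sinc x.

Lemma is_derive_bessel_j (nu : R) x : 2^-1 <= nu + 1 ->
  is_derive x 1 (bessel_j nu) (- (x / (2 * (nu + 1)) * bessel_j (nu + 1) x)).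
Proof.
move=> nu1.
rewrite (_ : bessel_j nu = hyp01 (nu + 1) \o (fun x => (x / 2) ^+ 2)); last first.
  by apply/funext => y; exact: bessel_jE.
have d := is_derive_hyp01 ((x / 2) ^+ 2) nu1.
have d2 : is_derive x 1 (fun x : R => (x / 2) ^+ 2) (x / 2).
  by apply: is_derive_eq; rewrite /GRing.scale/=; field.
have := @is_derive1_comp _ (hyp01 (nu + 1)) (fun x : R => (x / 2) ^+ 2) x _ _ d d2.
move=> dc; apply: is_derive_eq.
rewrite bessel_jE; last by lra.
rewrite /GRing.scale/=; field; lra.
Qed.

Instance is_derive_dunkl_cos x : is_derive x 1 dunkl_cos (- dunkl_sin x).
Proof.
apply: is_derive_eq; first exact: is_derive_bessel_j.
by rewrite /dunkl_sin /dunkl_sinc; field.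
Qed.

(** The contiguity relation of 0F1 in disguise.  Writing [dunkl_sinc x] in place
of [dunkl_sin x / x] makes the formula hold at 0 too. *)
Instance is_derive_dunkl_sin x : is_derive x 1 dunkl_sin
  (dunkl_cos x - (2 * mu + 1) * dunkl_sinc x).
Proof.
have mu2 : 2^-1 <= mu + 1 + 1 by have := mu_ge; lra.
have d := is_derive_bessel_j x mu2.
rewrite /dunkl_sin /dunkl_sinc; apply: is_derive_eq.
rewrite /dunkl_cos !bessel_jE//; last by have := mu_ge; lra.
rewrite (hyp01_contiguous _ mu1) /GRing.scale/=.
have -> : mu + 1 + 1 + 1 = mu + 1 + 2 by ring.
have mu2_neq0 : mu + 1 + 1 != 0 by rewrite gt_eqF//; lra.
by field; rewrite mu1_neq0 mu2_neq0.
Qed.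

Lemma dunkl_cos_continuous : continuous dunkl_cos.
Proof.
move=> x; apply: differentiable_continuous; apply/derivable1_diffP.
exact: ex_derive.
Qed.

Lemma dunkl_sin_continuous : continuous dunkl_sin.
Proof.
move=> x; apply: differentiable_continuous; apply/derivable1_diffP.
exact: ex_derive.
Qed.

Lemma dunkl_cosN x : dunkl_cos (- x) = dunkl_cos x.
Proof. by rewrite /dunkl_cos !bessel_jE// mulNr sqrrN. Qed.

Lemma dunkl_sinN x : dunkl_sin (- x) = - dunkl_sin x.
Proof.
rewrite /dunkl_sin /dunkl_sinc !bessel_jE ?mulNr ?sqrrN//; have := mu_ge; lra.
Qed.

(** An energy estimate: the derivative of the left-hand side is
[- 2 (2 mu + 1) x dunkl_sinc x ^ 2], so that the left-hand side decreases for
[x >= 0] from its value 1 at 0; it is even. *)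
Lemma dunkl_cos2Dsin2_le1 x : dunkl_cos x ^+ 2 + dunkl_sin x ^+ 2 <= 1.
Proof.
wlog x0 : x / 0 <= x => [h|].
  have [/h//|/ltW] := leP 0 x; rewrite -oppr_ge0 => /h.
  by rewrite dunkl_cosN dunkl_sinN sqrrN.
pose e x : R := dunkl_cos x ^+ 2 + dunkl_sin x ^+ 2.
have de (y : R) : is_derive y 1 e (- (2 * (2 * mu + 1) * y * dunkl_sinc y ^+ 2)).
  by apply: is_derive_eq; rewrite /GRing.scale/= /dunkl_sin; ring.
have -> : 1 = e 0.
  rewrite /e /dunkl_sin mul0r expr0n addr0 /dunkl_cos bessel_jE//.
  by rewrite mul0r expr0n hyp01_0 expr1n.
apply: (@ler0_derive1_nincry _ e 0) => //.
- move=> y; rewrite in_itv/= andbT => /ltW y0; rewrite derive1E derive_val.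
  have c : 0 <= 2 * mu + 1 by have := mu_ge; lra.
  by rewrite oppr_le0 mulr_ge0 ?sqr_ge0// mulr_ge0// mulr_ge0.
- apply: continuous_subspaceT => y; apply: differentiable_continuous.
  by apply/derivable1_diffP; exact: ex_derive.
Qed.

Lemma dunkl_cos_le1 x : `|dunkl_cos x| <= 1.
Proof.
rewrite -(@expr_le1 _ 2)// -normrX ger0_norm ?sqr_ge0//.
by apply: le_trans (dunkl_cos2Dsin2_le1 x); rewrite lerDl sqr_ge0.
Qed.

Lemma dunkl_sin_le1 x : `|dunkl_sin x| <= 1.
Proof.
rewrite -(@expr_le1 _ 2)// -normrX ger0_norm ?sqr_ge0//.
by apply: le_trans (dunkl_cos2Dsin2_le1 x); rewrite lerDr sqr_ge0.
Qed.

Lemma dunkl_EE (q : quat R) x y :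
  dunkl_E mu q x y = (dunkl_cos (x * y))%:A + dunkl_sin (x * y) *: q.
Proof.
rewrite /dunkl_E; congr (_ + _ *: _); rewrite /dunkl_sin /dunkl_sinc.
by rewrite mulrAC mulrA.
Qed.

End DunklKernelReal.

(** * Oscillating families of functions *)

Section WeakNull.
Import HBSimple.
Context d (T : measurableType d) (R : realType).
Variable m : {measure set T -> \bar R}.
Implicit Types (h g : T -> R) (A D : set T).

Definition L1 h : Prop := m.-integrable setT (EFin \o h).

Variables (phi : nat -> T -> R) (M : R).
Hypothesis mphi : forall n, measurable_fun setT (phi n).
Hypothesis phi_le : forall n x, `|phi n x| <= M.

(** Dominated convergence for real-valued functions. *)
Lemma L1_dominated_cvg (g_ : nat -> T -> R) h b :
  (forall k, measurable_fun setT (g_ k)) -> L1 b ->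
  (forall x, g_ k x @[k --> \oo] --> h x) -> (forall k x, `|g_ k x| <= b x) ->
  [/\ L1 h, \int[m]_x `|h x - g_ k x| @[k --> \oo] --> (0 : R) &
    \int[m]_x g_ k x @[k --> \oo] --> \int[m]_x h x].
Proof.
move=> mg bL gh gb.
have mh : measurable_fun setT h.
  apply: (@measurable_fun_cvg _ _ _ _ g_) => // x _; exact: gh.
have [] := @dominated_convergence _ _ _ m setT measurableT (fun k => EFin \o g_ k)
  (EFin \o h) (EFin \o b).
- by move=> k; exact/measurable_EFinP.
- exact/measurable_EFinP.
- by apply: aeW => x _; apply: cvg_EFin; [exact: nearW|exact: gh].
- exact: bL.
- by apply: aeW => x k _; rewrite lee_fin.
move=> hL c0 c1; split => //.
- rewrite (_ : (fun k => _) = fine \o (fun k => \int[m]_x `|(g_ k x)%:E - (h x)%:E|)%E).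
    exact: fine_cvg c0.
  by apply/funext => k; congr fine; apply: eq_integral => x _; rewrite /= distrC.
- by move: c1; rewrite -(fineK (integrable_fin_num measurableT hL)) => /fine_cvg.
Qed.

Lemma cvg_indic_bigcup (B : nat -> set T) x : nondecreasing_seq B ->
  (\1_(B k) x : R) @[k --> \oo] --> (\1_(\bigcup_k B k) x : R).
Proof.
move=> ndB; have [[i _ Bix]|Bx] := pselect ((\bigcup_k B k) x).
  apply: cvg_near_cst; near=> k.
  have Bkx : B k x.
    suff : B i `<=` B k by apply.
    by rewrite -subsetEset; apply: ndB; near: k; exact: nbhs_infty_ge.
  by rewrite !indicE !mem_set//; exists k.
apply: cvg_near_cst; apply: nearW => k; rewrite !indicE !memNset// => Bkx.
by apply: Bx; exists k.
Unshelve. all: by end_near. Qed.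

(** For a fixed [h] in [L1], convergence to 0 of [phi] tested against [h].  When
it holds for all [h], this is weak-star convergence of [phi] to 0 in the dual
of [L1]. *)
Definition weak_null h : Prop :=
  \int[m]_x (phi n x * h x) @[n --> \oo] --> (0 : R).

Lemma L1_mul h n : L1 h -> L1 (fun x => phi n x * h x).
Proof.
move=> hL; have mh : measurable_fun setT h by exact/measurable_EFinP/measurable_int/hL.
apply: (@le_integrable _ _ _ _ _ measurableT _ (fun x => (M%:E * (h x)%:E)%E)).
- by apply/measurable_EFinP; exact: measurable_funM.
- move=> x _ /=; rewrite lee_fin !normrM ler_wpM2r// (le_trans (phi_le _ _))//.
  exact: ler_norm.
- exact: integrableZl.
Qed.

Lemma L1D h g : L1 h -> L1 g -> L1 (fun x => h x + g x).
Proof. by move=> hL gL; exact: (integrableD measurableT hL gL). Qed.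

Lemma L1B h g : L1 h -> L1 g -> L1 (fun x => h x - g x).
Proof. by move=> hL gL; exact: (integrableB measurableT hL gL). Qed.

Lemma L1Z (k : R) h : L1 h -> L1 (fun x => k * h x).
Proof. by move=> hL; exact: (integrableZl measurableT k hL). Qed.

Lemma L1_indic A : measurable A -> (m A < +oo)%E -> L1 (fun x => \1_A x).
Proof.
move=> mA Aoo; apply/integrableP; split; first exact/measurable_EFinP/measurable_indic.
rewrite (eq_integral (fun x => (\1_A x)%:E)) ?integral_indic ?setIT//.
by move=> x _ /=; rewrite ger0_norm.
Qed.

Lemma weak_nullD h g : L1 h -> L1 g -> weak_null h -> weak_null g ->
  weak_null (fun x => h x + g x).
Proof.
move=> hL gL h0 g0; rewrite /weak_null -(addr0 0).
rewrite (_ : (fun n => _) = (fun n =>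
    \int[m]_x (phi n x * h x) + \int[m]_x (phi n x * g x))).
  exact: cvgD.
apply/funext => n; rewrite -RintegralD//; [|exact: L1_mul..].
by apply: eq_Rintegral => x _; rewrite mulrDr.
Qed.

Lemma weak_nullZ (k : R) h : L1 h -> weak_null h ->
  weak_null (fun x => k * h x).
Proof.
move=> hL h0; rewrite /weak_null -(mulr0 k).
rewrite (_ : (fun n => _) = (fun n => k * \int[m]_x (phi n x * h x))).
  exact: cvgMr.
apply/funext => n; rewrite -RintegralZl//; last exact: L1_mul.
by apply: eq_Rintegral => x _; rewrite mulrCA.
Qed.

Lemma weak_nullB h g : L1 h -> L1 g -> weak_null h -> weak_null g ->
  weak_null (fun x => h x - g x).
Proof.
move=> hL gL h0 g0.
rewrite (_ : (fun x => h x - g x) = (fun x => h x + -1 * g x)).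
  by apply: weak_nullD => //; [exact: L1Z|exact: weak_nullZ].
by apply/funext => x; rewrite mulN1r.
Qed.

Lemma weak_null0 : weak_null (fun=> 0).
Proof.
rewrite /weak_null (_ : (fun n => _) = cst 0); first exact: cvg_cst.
apply/funext => n; rewrite /Rintegral.
by under eq_integral do rewrite mulr0; rewrite integral0.
Qed.

Lemma weak_null_sum (I : Type) (s : seq I) (f : I -> T -> R) :
  (forall i, L1 (f i)) -> (forall i, weak_null (f i)) ->
  weak_null (fun x => \sum_(i <- s) f i x).
Proof.
move=> fL f0; suff : L1 (fun x => \sum_(i <- s) f i x) /\
  weak_null (fun x => \sum_(i <- s) f i x) by case.
elim: s => [|i s [IHL IH]].
  under eq_fun do rewrite big_nil; split; last exact: weak_null0.
  exact: integrable0.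
under eq_fun do rewrite big_cons; split; first exact: L1D.
exact: weak_nullD.
Qed.

(** As [phi] is uniformly bounded, the set of test functions is closed
in [L1]. *)
Lemma weak_null_closed h (g_ : nat -> T -> R) : L1 h -> (forall k, L1 (g_ k)) ->
  (forall k, weak_null (g_ k)) ->
  \int[m]_x `|h x - g_ k x| @[k --> \oo] --> (0 : R) -> weak_null h.
Proof.
move=> hL gL g0 hg; apply/cvgr0Pnorm_lt => e e0.
have e20 : 0 < e / 2 by rewrite divr_gt0.
have M1 : 0 < `|M| + 1 by rewrite ltr_wpDl.
have d0 : 0 < e / 2 / (`|M| + 1) by rewrite divr_gt0.
have [k _ /(_ _ (leqnn k)) /= hk] := (cvgr0Pnorm_lt _).1 hg _ d0.
have /cvgr0Pnorm_lt/(_ _ e20) := g0 k; apply: filterS => n gn.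
have -> : \int[m]_x (phi n x * h x) =
    \int[m]_x (phi n x * g_ k x) + \int[m]_x (phi n x * (h x - g_ k x)).
  rewrite -RintegralD//; [|exact: L1_mul|exact: (L1_mul n (L1B hL (gL k)))].
  by apply: eq_Rintegral => x _; rewrite -mulrDr addrC subrK.
rewrite (le_lt_trans (ler_normD _ _))// (splitr e) ltr_leD//.
have hgL : L1 (fun x => h x - g_ k x) by exact: L1B.
rewrite (le_trans (le_normr_Rintegral _ (L1_mul n hgL)))//.
apply: (@le_trans _ _ (\int[m]_x ((`|M| + 1) * `|h x - g_ k x|))).
  apply: le_Rintegral => //.
  - exact: integrable_norm (L1_mul n hgL).
  - by apply: L1Z; exact: integrable_norm hgL.
  - move=> x _; rewrite normrM ler_wpM2r// (le_trans (phi_le _ _))//.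
    by rewrite (le_trans (ler_norm _))// lerDl.
rewrite RintegralZl//; last exact: integrable_norm hgL.
rewrite mulrC -ler_pdivlMr// (le_trans _ (ltW hk))//; exact: ler_norm.
Qed.

Lemma weak_null_setU_disj A B : measurable A -> measurable B ->
  (m A < +oo)%E -> (m B < +oo)%E -> A `&` B = set0 ->
  weak_null (fun x => \1_A x) -> weak_null (fun x => \1_B x) ->
  weak_null (fun x => \1_(A `|` B) x).
Proof.
move=> mA mB Aoo Boo AB0 A0 B0.
rewrite (_ : (fun x => \1_(A `|` B) x) = (fun x => \1_A x + \1_B x)).
  by apply: weak_nullD => //; exact: L1_indic.
apply/funext => x; rewrite !indicE in_setU.
have : x \in A `&` B = false by rewrite AB0 in_set0.
by rewrite in_setI; case: (x \in A); case: (x \in B) => //= _; rewrite ?addr0 ?add0r.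
Qed.

(** The sets [A] such that [phi] is null against the indicator of [D `&` A] form
a lambda-system: complements use the hypothesis on [D], countable disjoint
unions use closedness in [L1].  By Dynkin's theorem a generating pi-system
suffices. *)
Lemma weak_null_dynkin (G : set (set T)) D :
  @measurable _ T = <<s G >> -> setI_closed G -> measurable D -> (m D < +oo)%E ->
  weak_null (fun x => \1_D x) ->
  (forall A, G A -> weak_null (fun x => \1_(D `&` A) x)) ->
  forall A, measurable A -> weak_null (fun x => \1_(D `&` A) x).
Proof.
move=> GE GI mD Doo D0 DG A; rewrite GE; move: A.
have DIoo B : measurable B -> (m (D `&` B) < +oo)%E.
  move=> mB; apply: le_lt_trans Doo; apply: le_measure; rewrite ?inE//.
  exact: measurableI.
apply: (dynkin_induction GE GI); rewrite ?setIT//.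
- move=> B mB B0; rewrite (_ : (fun x => _) = (fun x => \1_D x - \1_(D `&` B) x)).
    apply: weak_nullB => //; apply: L1_indic => //; first exact: measurableI.
    exact: DIoo.
  apply/funext => x; rewrite !indicE !in_setI in_setC.
  by case: (x \in D); case: (x \in B); rewrite /= ?subr0 ?subrr.
- move=> F mF tF F0.
  pose B k := D `&` \big[setU/set0]_(i < k) F i.
  have mU k : measurable (\big[setU/set0]_(i < k) F i) by exact: bigsetU_measurable.
  apply: (@weak_null_closed _ (fun k x => \1_(B k) x)).
  + by apply: L1_indic; [exact/measurableI/bigcup_measurable|exact/DIoo/bigcup_measurable].
  + by move=> k; apply: L1_indic; [exact/measurableI|exact/DIoo].
  + elim=> [|k IH].
      rewrite /B big_ord0 setI0 (_ : (fun x => _) = fun=> 0); first exact: weak_null0.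
      by apply/funext => x; rewrite indic0.
    rewrite /B big_ord_recr/= setIUr; apply: weak_null_setU_disj => //.
    * exact: measurableI mD (mU k).
    * exact: measurableI mD (mF k).
    * exact: DIoo (mU k).
    * exact: DIoo (mF k).
    * apply/seteqP; split => // x [[_ +] [_ Fkx]].
      rewrite -bigcup_mkord => -[i /= ik Fix].
      have ik' : i = k by apply: tF => //; exists x.
      by rewrite ik' ltnn in ik.
  + have -> : D `&` \bigcup_k F k = \bigcup_k B k.
      apply/seteqP; split => [x [Dx [k _ Fkx]]|x [k _ [Dx]]].
        by exists k.+1 => //; split => //; rewrite -bigcup_mkord; exists k => /=.
      by rewrite -bigcup_mkord => -[i _ Fix]; split => //; exists i.
    have ndB : nondecreasing_seq B.
      move=> i j ij; rewrite subsetEset; apply: setIS.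
      exact: subset_bigsetU.
    have [] := @L1_dominated_cvg (fun k x => \1_(B k) x)
      (fun x => \1_(\bigcup_k B k) x) (fun x => \1_D x).
    * by move=> k; apply: measurable_indic; exact: measurableI.
    * exact: L1_indic.
    * by move=> x; exact: cvg_indic_bigcup.
    * move=> k x; rewrite !indicE in_setI.
      case: (x \in D) => /=; rewrite ?normr0//.
      by case: (x \in _); rewrite ?normr1 ?normr0.
    * by [].
Qed.

(** Two density arguments in [L1]: the truncations of [h] to the sets [D k]
converge to [h], and each truncation is a limit of simple functions. *)
Lemma weak_null_exhaust (D : nat -> set T) h :
  (forall k, measurable (D k)) -> (forall k, (m (D k) < +oo)%E) ->
  nondecreasing_seq D -> \bigcup_k D k = setT ->
  (forall k A, measurable A -> weak_null (fun x => \1_(D k `&` A) x)) ->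
  L1 h -> weak_null h.
Proof.
move=> mD Doo ndD UD DA hL.
have mh : measurable_fun setT h by exact/measurable_EFinP/measurable_int/hL.
have hDL g k : m.-integrable (D k) (EFin \o g) -> L1 (fun x => g x * \1_(D k) x).
  move=> /(integrable_mkcond _ (mD k)); apply: eq_integrable => // x _.
  rewrite /= patchE indicE.
  by case: (x \in D k); rewrite ?mulr1 ?mulr0.
suff hD k : weak_null (fun x => h x * \1_(D k) x).
  have hDkL k : L1 (fun x => h x * \1_(D k) x) by apply: hDL; exact: integrableS hL.
  have [] := @L1_dominated_cvg (fun k x => h x * \1_(D k) x) h (fun x => `|h x|).
  - by move=> k; apply: measurable_funM => //; exact: measurable_indic.
  - exact: integrable_norm.
  - move=> x; rewrite -[X in _ --> X](mulr1 (h x)).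
    have -> : 1 = \1_(\bigcup_k D k) x :> R by rewrite UD indicT.
    by apply: cvgMr; exact: cvg_indic_bigcup.
  - move=> k x; rewrite normrM indicE.
    by case: (x \in D k); rewrite ?normr1 ?mulr1// normr0 mulr0.
  by move=> _ hDk _; exact: (weak_null_closed hL hDkL hD).
have hDk : m.-integrable (D k) (EFin \o h) by exact: integrableS hL.
have [g [gL _ gh]] := approximation_sfun_integrable (mD k) hDk.
apply: (@weak_null_closed _ (fun j x => g j x * \1_(D k) x)).
- exact: hDL.
- move=> j; exact: hDL.
- move=> j; rewrite (_ : (fun x => _) = (fun x =>
    \sum_(y <- finmap.enum_fset (fset_set (range (g j))))
     (y * \1_(D k `&` g j @^-1` [set y]) x))).
    have mgy y : measurable (D k `&` g j @^-1` [set y]).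
      by apply: measurableI => //; exact: measurable_funPTI.
    have gyL y : L1 (fun x => \1_(D k `&` g j @^-1` [set y]) x).
      apply: L1_indic => //; apply: le_lt_trans (Doo k).
      by apply: le_measure; rewrite ?inE.
    apply: weak_null_sum => y; first exact: L1Z.
    by apply: weak_nullZ => //; apply: DA; exact: measurable_funPTI.
  apply/funext => x; rewrite fimfunE fsbig_finite//= mulr_suml.
  by apply: eq_bigr => y _; rewrite indicI/= -mulrA; congr (_ * _); exact: mulrC.
- rewrite (_ : (fun j => _) = fine \o (fun j =>
      \int[m]_(x in D k) `|(h x)%:E - (g j x)%:E|)%E); first exact: fine_cvg gh.
  apply/funext => j; congr fine; rewrite [RHS]integral_mkcond.
  apply: eq_integral => x _; rewrite /= patchE indicE.
  by case: (x \in D k); rewrite ?mulr1// !mulr0 subrr normr0.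
Qed.

End WeakNull.

(** * The Riemann-Lebesgue lemma on the line *)

Section Oscillation.
Context {R : realType}.
Local Notation leb := (@lebesgue_measure R).
Local Notation line := (measurableTypeR R).
Implicit Types (h : line -> R) (lam : nat -> R).

Definition centered_itv k : set line := `](- k%:R), k%:R]%classic.

Lemma measurable_centered_itv k : measurable (centered_itv k).
Proof. exact: measurable_itv. Qed.

Lemma centered_itv_lty k : (leb (centered_itv k) < +oo)%E.
Proof. by rewrite lebesgue_measure_itv/=; case: ifPn => _; rewrite ?ltry. Qed.

Lemma nd_centered_itv : nondecreasing_seq centered_itv.
Proof.
move=> i j ij; rewrite subsetEset => x; rewrite /centered_itv/= !in_itv/= => /andP[ix xi].
have ijR : i%:R <= j%:R :> R by rewrite ler_nat.
by rewrite (le_lt_trans _ ix) ?lerN2//= (le_trans xi).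
Qed.

Lemma bigcup_centered_itv : \bigcup_k centered_itv k = setT.
Proof.
apply/seteqP; split => // x _; exists (Num.truncn `|x|).+1 => //=.
have := truncnS_gt `|x|; rewrite ltr_norml => /andP[kx xk].
by rewrite /centered_itv/= in_itv/= kx ltW.
Qed.

Lemma weak_null_ocitv (phi : nat -> line -> R) M :
  (forall n, measurable_fun setT (phi n)) -> (forall n x, `|phi n x| <= M) ->
  (forall a b : R, a < b -> weak_null leb phi (fun x => \1_`]a, b] x)) ->
  forall h, L1 leb h -> weak_null leb phi h.
Proof.
move=> mphi phi_le phi0 h hL.
have oc0 (A : set line) : (@ocitv R) A -> weak_null leb phi (fun x => \1_A x).
  move=> [[a b] _ /= <-]; have [/phi0//|ba] := ltP a b.
  rewrite set_itv_ge ?bnd_simp -?leNgt// (_ : (fun x => _) = fun=> 0).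
    exact: weak_null0.
  by apply/funext => x; rewrite indic0.
have ocD k : (@ocitv R) (centered_itv k) by exists (- k%:R, k%:R).
apply: (weak_null_exhaust mphi phi_le measurable_centered_itv centered_itv_lty) => //.
- exact: nd_centered_itv.
- exact: bigcup_centered_itv.
- move=> k; apply: (weak_null_dynkin mphi phi_le (G := @ocitv R)) => //.
  + exact: (@ocitvI R).
  + exact: measurable_centered_itv.
  + exact: centered_itv_lty.
  + exact: oc0 (ocD k).
  + by move=> A ocA; apply: oc0; exact: ocitvI.
Qed.

Lemma continuous_dilate (phi : R -> R) (l : R) : continuous phi ->
  continuous (fun x : R => phi (l * x)).
Proof.
move=> cphi x; apply: continuous_comp; last exact: cphi.
exact: mulrl_continuous.
Qed.

Lemma measurable_dilate (phi : R -> R) (l : R) : continuous phi ->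
  measurable_fun setT (fun x : line => phi (l * x)).
Proof.
move=> cphi; apply: continuous_measurable_fun. exact: continuous_dilate.
Qed.

(** The integral of [phi (lam x)] over an interval with endpoints [a], [b] is
[(Phi (lam b) - Phi (lam a)) / lam], which is at most [2 B / |lam|]. *)
Lemma weak_null_derive (phi Phi : R -> R) lam (M B : R) : continuous phi ->
  (forall x, `|phi x| <= M) -> (forall x : R, is_derive x 1 Phi (phi x)) ->
  (forall x, `|Phi x| <= B) -> `|lam n| @[n --> \oo] --> +oo ->
  forall h, L1 leb h -> weak_null leb (fun n x => phi (lam n * x)) h.
Proof.
move=> cphi phi_le dPhi Phi_le lamoo.
have cphil (l : R) := @continuous_dilate phi l cphi.
apply: weak_null_ocitv => // [n|a b ab].
  exact: continuous_measurable_fun.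
apply/cvgr0Pnorm_le => e e0; near=> n.
have l0 : 0 < `|lam n| by near: n; move/cvgryPgt : lamoo; exact.
have l1 : 2 * B / e <= `|lam n| by near: n; move/cvgryPge : lamoo; exact.
have -> : \int[leb]_x (phi (lam n * x) * \1_`]a, b] x) =
    (Phi (lam n * b) - Phi (lam n * a)) / lam n.
  have lam0 : lam n != 0 by rewrite -normr_gt0.
  have -> : \int[leb]_x (phi (lam n * x) * \1_`]a, b] x) =
      \int[leb]_(x in `]a, b]) phi (lam n * x).
    rewrite [RHS]Rintegral_mkcond; apply: eq_Rintegral => x _.
    by rewrite patchE indicE; case: (x \in _); rewrite ?mulr1 ?mulr0.
  rewrite /Rintegral integral_itv_obnd_cbnd; last first.
    apply/measurable_EFinP.
    exact: (measurable_funTS (continuous_measurable_fun (cphil _))).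
  have dF (x : R) : a <= x <= b ->
      is_derive x 1 (fun x => Phi (lam n * x) / lam n) (phi (lam n * x)).
    move=> _; have d := dPhi (lam n * x).
    have d2 : is_derive x 1 (fun x : R => lam n * x) (lam n).
      by apply: is_derive_eq; rewrite /GRing.scale/= mulr1.
    have d3 := @is_derive1_comp _ Phi (fun x : R => lam n * x) x _ _ d d2.
    pose F x := (lam n)^-1 *: (Phi \o ( *%R (lam n))) x.
    have d4 : is_derive x 1 F (phi (lam n * x)).
      by apply: is_derive_eq; rewrite /GRing.scale/=; field.
    by rewrite (_ : (fun x => _) = F)//; apply/funext => y; rewrite mulrC.
  rewrite (integral_derive ab dF)//=; first by field.
  by move=> x _; exact: cphil.
rewrite normrM normfV ler_pdivrMr//.
rewrite (le_trans (ler_normB _ _))//.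
rewrite (@le_trans _ _ (2 * B))//; last by rewrite [leRHS]mulrC -ler_pdivrMr.
by rewrite (_ : 2 * B = B + B) ?lerD//; ring.
Unshelve. all: by end_near. Qed.

Variable mu : R.
Hypothesis mu_ge : - 2^-1 <= mu.

Let dunkl_sinc_le1 x : `|dunkl_sinc mu x| <= 1.
Proof.
have mu1 : 1 <= 2 * (mu + 1) by have := mu_ge; lra.
have mu0 : 0 < 2 * (mu + 1) by lra.
rewrite /dunkl_sinc normrM normfV (ger0_norm (ltW mu0)) ler_pdivrMr// mul1r.
apply: le_trans mu1; apply: dunkl_cos_le1; have := mu_ge; lra.
Qed.

Let dunkl_sinc_continuous : continuous (dunkl_sinc mu).
Proof.
move=> x; apply: cvgMl; apply: dunkl_cos_continuous; have := mu_ge; lra.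
Qed.

Lemma weak_null_dunkl_sin lam h : `|lam n| @[n --> \oo] --> +oo -> L1 leb h ->
  weak_null leb (fun n x => dunkl_sin mu (lam n * x)) h.
Proof.
move=> lamoo; apply: (@weak_null_derive _ (fun x => - dunkl_cos mu x) _ 1 1) => //.
- exact: dunkl_sin_continuous.
- exact: dunkl_sin_le1.
- move=> x; have d := is_derive_dunkl_cos mu_ge x.
  by apply: is_derive_eq; rewrite opprK.
- by move=> x; rewrite normrN; exact: dunkl_cos_le1.
Qed.

(** The function [dunkl_cos - (2 mu + 1) dunkl_sinc] has the bounded primitive
[dunkl_sin].  The correction is handled separately: [dunkl_sinc] tends to 0 at
infinity, so dominated convergence applies. *)
Lemma weak_null_dunkl_cos lam h : `|lam n| @[n --> \oo] --> +oo -> L1 leb h ->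
  weak_null leb (fun n x => dunkl_cos mu (lam n * x)) h.
Proof.
move=> lamoo hL.
pose psi x : R := dunkl_cos mu x - (2 * mu + 1) * dunkl_sinc mu x.
have cpsi : continuous psi.
  move=> x; apply: cvgB; first exact: dunkl_cos_continuous.
  by apply: cvgMr; exact: dunkl_sinc_continuous.
have psi_le x : `|psi x| <= 1 + (2 * mu + 1).
  have c0 : 0 <= 2 * mu + 1 by have := mu_ge; lra.
  rewrite (le_trans (ler_normB _ _))// lerD//; first exact: dunkl_cos_le1.
  by rewrite normrM ger0_norm// ler_piMr.
have mpsi n : measurable_fun setT (fun x : line => psi (lam n * x)).
  exact: measurable_dilate.
have msinc n : measurable_fun setT (fun x : line => dunkl_sinc mu (lam n * x)).
  exact: measurable_dilate.
have psi_null : weak_null leb (fun n x => psi (lam n * x)) h.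
  apply: (@weak_null_derive psi (dunkl_sin mu) lam (1 + (2 * mu + 1)) 1) => //.
  - exact: is_derive_dunkl_sin.
  - exact: dunkl_sin_le1.
have sinc_null : weak_null leb (fun n x => dunkl_sinc mu (lam n * x)) h.
  have leb0 : (leb ([set 0%R] : set line) < +oo)%E.
    by rewrite lebesgue_measure_set1 ltry.
  have [] := @L1_dominated_cvg _ _ _ leb
      (fun n x => dunkl_sinc mu (lam n * x) * h x)
      (fun x => dunkl_sinc mu 0 * h 0 * \1_[set 0] x) (fun x => `|h x|).
  - by move=> n; apply: measurable_funM (msinc n) _; exact/measurable_EFinP/measurable_int/hL.
  - exact: integrable_norm.
  - move=> x; have [->|x0] := eqVneq x 0.
      rewrite indicE mem_set// mulr1; under eq_fun do rewrite mulr0.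
      exact: cvg_cst.
    rewrite indicE memNset; last exact/eqP.
    rewrite mulr0 -[X in _ --> X](mul0r (h x)); apply: cvgMl.
    apply/cvgr0Pnorm_le => e e0; near=> n.
    have l0 : 0 < `|lam n| by near: n; move/cvgryPgt : lamoo; exact.
    have l1 : (e * `|x|)^-1 <= `|lam n| by near: n; move/cvgryPge : lamoo; exact.
    have nx0 : 0 < `|lam n * x| by rewrite normrM mulr_gt0// normr_gt0.
    rewrite -(ler_pM2l nx0) -normrM (le_trans (dunkl_sin_le1 mu_ge _))//.
    by rewrite normrM -mulrA [_ * e]mulrC -ler_pdivrMr ?mul1r// mulr_gt0// normr_gt0.
  - by move=> n x; rewrite normrM ler_piMl.
  move=> _ _; rewrite [X in _ --> X](_ : _ = 0)//.
  rewrite RintegralZl//; last exact: L1_indic.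
  rewrite /Rintegral [X in fine X](_ : _ = 0%E) ?mulr0// integral_indic// setIT.
  exact: lebesgue_measure_set1.
rewrite /weak_null (_ : (fun n => _) = (fun n => \int[leb]_x (psi (lam n * x) * h x)
    + (2 * mu + 1) * \int[leb]_x (dunkl_sinc mu (lam n * x) * h x))).
  rewrite -[X in _ --> X]addr0; apply: cvgD => //.
  by rewrite -[X in _ --> X](mulr0 (2 * mu + 1)); exact: cvgMr.
apply/funext => n.
have sincL : L1 leb (fun x => dunkl_sinc mu (lam n * x) * h x).
  exact: (@L1_mul _ _ _ leb (fun n x => dunkl_sinc mu (lam n * x)) 1).
have psiL : L1 leb (fun x => psi (lam n * x) * h x).
  exact: (@L1_mul _ _ _ leb (fun n x => psi (lam n * x)) (1 + (2 * mu + 1))).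
rewrite -RintegralZl// -RintegralD//; last exact: L1Z.
by apply: eq_Rintegral => x _; rewrite /psi; ring.
Unshelve. all: by end_near. Qed.

End Oscillation.

(** * The Riemann-Lebesgue lemma on a product *)

Section WeakNullProduct.
Context d1 d2 (T1 : measurableType d1) (T2 : measurableType d2) (R : realType).
Variables (m1 : {sigma_finite_measure set T1 -> \bar R})
          (m2 : {sigma_finite_measure set T2 -> \bar R}).
Local Notation m12 := (m1 \x m2)%E.

Lemma Rintegral_tensor (a : T1 -> R) (b : T2 -> R) : L1 m1 a -> L1 m2 b ->
  L1 m12 (fun v => a v.1 * b v.2) ->
  \int[m12]_v (a v.1 * b v.2) = (\int[m1]_x a x) * (\int[m2]_y b y).
Proof.
move=> aL bL abL; rewrite {1}/Rintegral -integral12_prod_meas1//=.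
rewrite (eq_integral (fun x => (\int[m2]_y (b y)%:E * (a x)%:E)%E)).
  rewrite -(fineK (integrable_fin_num measurableT bL)) integralZl//.
  rewrite [RHS]mulrC fineM; [by []|by []|].
  exact: integrable_fin_num.
move=> x _; rewrite /fubini_F muleC -integralZl//.
Qed.

Variables (alpha : nat -> T1 -> R) (beta : nat -> T2 -> R).
Hypothesis malpha : forall n, measurable_fun setT (alpha n).
Hypothesis mbeta : forall n, measurable_fun setT (beta n).
Hypothesis alpha_le : forall n x, `|alpha n x| <= 1.
Hypothesis beta_le : forall n y, `|beta n y| <= 1.

Let gam n (v : T1 * T2) := alpha n v.1 * beta n v.2.

Let mgam n : measurable_fun setT (gam n).
Proof.
apply: measurable_funM.
  by apply: measurableT_comp => //; exact: measurable_fst.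
by apply: measurableT_comp => //; exact: measurable_snd.
Qed.

Let gam_le n v : `|gam n v| <= 1.
Proof. by rewrite normrM mulr_ile1. Qed.

(** The hypothesis on integrals is what Fubini's theorem leaves to prove for the
indicator of a rectangle.  It is symmetric in the two factors, so that either
of them may be the oscillating one. *)
Lemma weak_null_tensor (D1 : nat -> set T1) (D2 : nat -> set T2) :
  (forall k, measurable (D1 k)) -> (forall k, measurable (D2 k)) ->
  (forall k, (m1 (D1 k) < +oo)%E) -> (forall k, (m2 (D2 k) < +oo)%E) ->
  nondecreasing_seq D1 -> nondecreasing_seq D2 ->
  \bigcup_k D1 k = setT -> \bigcup_k D2 k = setT ->
  (forall h1 h2, L1 m1 h1 -> L1 m2 h2 ->
     (\int[m1]_x (alpha n x * h1 x)) * (\int[m2]_y (beta n y * h2 y))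
       @[n --> \oo] --> (0 : R)) ->
  forall h, L1 m12 h -> weak_null m12 gam h.
Proof.
move=> mD1 mD2 D1oo D2oo nD1 nD2 UD1 UD2 ab0 h hL.
pose D k := D1 k `*` D2 k.
have mD k : measurable (D k) by exact: measurableX.
have m12E A B : measurable A -> measurable B -> m12 (A `*` B) = (m1 A * m2 B)%E.
  by move=> mA mB; rewrite product_measure1E.
have finM A B : (m1 A < +oo)%E -> (m2 B < +oo)%E -> (m1 A * m2 B < +oo)%E.
  by move=> Aoo Boo; rewrite ltey_eq fin_numM// ge0_fin_numE.
have Doo k : (m12 (D k) < +oo)%E by rewrite m12E// finM.
have tensor0 A B : measurable A -> measurable B -> (m1 A < +oo)%E -> (m2 B < +oo)%E ->
    weak_null m12 gam (fun v => \1_(A `*` B) v).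
  move=> mA mB Aoo Boo.
  have AL : L1 m1 (fun x => \1_A x) by exact: L1_indic.
  have BL : L1 m2 (fun x => \1_B x) by exact: L1_indic.
  have ABL : L1 m12 (fun v => \1_(A `*` B) v).
    have ABoo : (m12 (A `*` B) < +oo)%E by rewrite m12E// finM.
    by apply: L1_indic => //; exact: measurableX.
  have := ab0 _ _ AL BL; apply: cvg_trans; apply: near_eq_cvg; apply: nearW => n.
  have E v : gam n v * \1_(A `*` B) v =
      (alpha n v.1 * \1_A v.1) * (beta n v.2 * \1_B v.2).
    by rewrite /gam !indicE in_setX -mulnb natrM mulrACA.
  rewrite -Rintegral_tensor; first by apply: eq_Rintegral => v _; rewrite E.
  - exact: (@L1_mul _ _ _ m1 alpha 1).
  - exact: (@L1_mul _ _ _ m2 beta 1).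
  - have := @L1_mul _ _ _ m12 gam 1 mgam gam_le _ n ABL.
    by under eq_fun do rewrite E.
apply: (weak_null_exhaust mgam gam_le mD Doo) => //.
- move=> i j ij; rewrite subsetEset => -[x y] [/= Dx Dy]; split.
    by move: x Dx; apply/subsetPset/nD1.
  by move: y Dy; apply/subsetPset/nD2.
- apply/seteqP; split => // -[x y] _.
  have [i _ ix] : (\bigcup_k D1 k) x by rewrite UD1.
  have [j _ jy] : (\bigcup_k D2 k) y by rewrite UD2.
  exists (maxn i j) => //; split => /=.
    suff : D1 i `<=` D1 (maxn i j) by apply.
    by rewrite -subsetEset; apply: nD1; exact: leq_maxl.
  suff : D2 j `<=` D2 (maxn i j) by apply.
  by rewrite -subsetEset; apply: nD2; exact: leq_maxr.
- move=> k; apply: (weak_null_dynkin mgam gam_le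
    (G := [set A `*` B | A in measurable & B in measurable])) => //.
  + exact: measurable_prod_measurableType.
  + move=> _ _ [A1 mA1 [A2 mA2 <-]] [B1 mB1 [B2 mB2 <-]].
    exists (A1 `&` B1); first exact: measurableI.
    exists (A2 `&` B2); first exact: measurableI.
    by rewrite setXI.
  + exact: Doo.
  + exact: tensor0.
  + move=> _ [A mA [B mB <-]]; rewrite /D -setXI; apply: tensor0.
    * exact: measurableI.
    * exact: measurableI.
    * by apply: le_lt_trans (D1oo k); apply: le_measure; rewrite ?inE//; exact: measurableI.
    * by apply: le_lt_trans (D2oo k); apply: le_measure; rewrite ?inE//; exact: measurableI.
Qed.

End WeakNullProduct.

(** * Measures with a density *)

Section Density.
Import HBNNSimple.
Context d (T : measurableType d) (R : realType).
Variables (m nu : {measure set T -> \bar R}) (w : T -> R).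
Hypothesis mw : measurable_fun setT w.
Hypothesis w_ge0 : forall x, 0 <= w x.
Hypothesis nuE : forall A, measurable A -> nu A = (\int[m]_(x in A) (w x)%:E)%E.

Lemma ge0_integral_density (f : T -> \bar R) : measurable_fun setT f ->
  (forall x, 0 <= f x)%E ->
  (\int[nu]_x f x = \int[m]_x (f x * (w x)%:E))%E.
Proof.
move=> mf f0; pose f_ := nnsfun_approx measurableT mf.
have mEw : measurable_fun setT (EFin \o w) by exact/measurable_EFinP.
transitivity (limn (fun n => \int[nu]_x (f_ n x)%:E)%E).
  rewrite -monotone_convergence//.
  - apply: eq_integral => x _; apply/esym/cvg_lim => //.
    exact: cvg_nnsfun_approx.
  - by move=> n; exact/measurable_EFinP.
  - by move=> n x _; rewrite lee_fin.
  - by move=> x _ i j ij; rewrite lee_fin; exact/lefP/nd_nnsfun_approx.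
transitivity (limn (fun n => \int[m]_x ((f_ n x)%:E * (w x)%:E))%E); last first.
  rewrite -monotone_convergence//.
  - apply: eq_integral => x _; apply/cvg_lim => //.
    by apply: cvgeZr => //; exact: cvg_nnsfun_approx.
  - by move=> n; apply: emeasurable_funM => //; exact/measurable_EFinP.
  - by move=> n x _; rewrite mule_ge0 ?lee_fin.
  - move=> x _ i j ij; rewrite lee_wpmul2r ?lee_fin//.
    exact/lefP/nd_nnsfun_approx.
congr (limn _); apply/funext => n.
transitivity (\int[nu]_x (\sum_(y \in range (f_ n))
    (y * \1_(f_ n @^-1` [set y]) x)%:E))%E.
  by apply: eq_integral => x _; rewrite fimfunE -fsumEFin.
rewrite ge0_integral_fsum//; last 2 first.
  - by move=> y; apply/measurable_EFinP; exact: measurable_funM.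
  - by move=> y x _; exact: nnfun_muleindic_ge0.
transitivity (\int[m]_x (\sum_(y \in range (f_ n))
    ((y * \1_(f_ n @^-1` [set y]) x)%:E * (w x)%:E)))%E; last first.
  apply: eq_integral => x _; rewrite -ge0_mule_fsuml => [|y]; last exact: nnfun_muleindic_ge0.
  by rewrite fsumEFin// -(fimfunE _ x).
rewrite ge0_integral_fsum//; last 2 first.
  - by move=> y; apply: emeasurable_funM => //; apply/measurable_EFinP; exact: measurable_funM.
  - by move=> y x _; rewrite mule_ge0 ?lee_fin// -lee_fin; exact: nnfun_muleindic_ge0.
apply: eq_fsbigr => r; rewrite inE => -[t _ tr].
have r0 : 0 <= r by rewrite -tr.
have mr : measurable (f_ n @^-1` [set r]) by exact: measurable_funPTI.
under eq_integral do rewrite EFinM.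
rewrite ge0_integralZl//; last exact/measurable_EFinP/measurable_indic.
rewrite integral_indic// setIT nuE//.
under [RHS]eq_integral do rewrite EFinM -muleA.
rewrite ge0_integralZl//; last 2 first.
  - by apply: emeasurable_funM => //; exact/measurable_EFinP/measurable_indic.
  - by move=> x _; rewrite mule_ge0 ?lee_fin.
congr (_ * _)%E; rewrite integral_mkcond.
by apply: eq_integral => x _; rewrite muleC epatch_indic.
Qed.

Lemma L1_density (h : T -> R) : L1 nu h -> L1 m (fun x => h x * w x).
Proof.
move=> /integrableP[mh hoo]; apply/integrableP; split.
  by apply/measurable_EFinP; apply: measurable_funM => //; exact/measurable_EFinP.
move: hoo; rewrite ge0_integral_density//; last exact: measurableT_comp.
apply: le_lt_trans; rewrite le_eqVlt; apply/orP; left; apply/eqP.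
by apply: eq_integral => x _; rewrite /= normrM EFinM (ger0_norm (w_ge0 x)).
Qed.

Lemma Rintegral_density (h : T -> R) : L1 nu h ->
  \int[nu]_x h x = \int[m]_x (h x * w x).
Proof.
move=> hL; have mh := measurable_int _ hL; rewrite /Rintegral; congr fine.
rewrite [LHS]integralE [RHS]integralE; congr (_ - _)%E.
  rewrite ge0_integral_density//; last exact: measurable_funepos.
  apply: eq_integral => x _; rewrite !funeposE -!EFin_max -EFinM; congr EFin.
  by rewrite maxr_pMl// mul0r.
rewrite ge0_integral_density//; last exact: measurable_funeneg.
apply: eq_integral => x _; rewrite !funenegE -!EFinN -!EFin_max -EFinM; congr EFin.
by rewrite maxr_pMl// mul0r mulNr.
Qed.

End Density.

(** * Sequential criteria for C0 functions of the plane *)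

Section SequentialC0.
Context {R : realType}.
Implicit Types (F u : R * R -> R) (v w : R * R).

Definition C0 F : Prop := continuous F /\
  forall e : R, 0 < e -> exists M : R, forall v, M < euclid_norm v -> `|F v| < e.

Lemma continuous_seqP F : (forall (z : nat -> R * R) p,
    z n @[n --> \oo] --> p -> F (z n) @[n --> \oo] --> F p) -> continuous F.
Proof.
move=> seqF p; apply/cvgrPdist_lt => e e0; apply: contrapT => nF.
have /choice[z zP] : forall n : nat, exists v,
    ball p n.+1%:R^-1 v /\ e <= `|F p - F v|.
  move=> n; apply: contrapT => /forallNP nz; apply: nF.
  have n0 : 0 < n.+1%:R^-1 :> R by rewrite invr_gt0.
  apply: filterS (nbhsx_ballx p _ n0) => v pv; by have /not_andP[//|/negP] := nz v; rewrite -ltNge.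
have zp : z n @[n --> \oo] --> p.
  apply/cvg_ballP => r r0; near=> n; have [pz _] := zP n.
  apply: le_ball pz; apply: ltW; near: n; exact: (near_infty_natSinv_lt (PosNum r0)).
have /cvgrPdist_lt/(_ _ e0)[n _ /(_ n (leqnn n)) /=] := seqF _ _ zp.
by have [_] := zP n; rewrite leNgt => /negbTE ->.
Unshelve. all: by end_near. Qed.

Lemma euclid_norm_le v : euclid_norm v <= `|v.1| + `|v.2|.
Proof.
rewrite -ler_sqr ?nnegrE ?sqrtr_ge0 ?addr_ge0// sqr_sqrtr ?addr_ge0 ?sqr_ge0//.
rewrite sqrrD !real_normK ?num_real// -addrA [_ *+ 2 + _]addrC addrA lerDl.
by rewrite mulrn_wge0// mulr_ge0.
Qed.

(** A sequence that leaves every bounded set need not have a coordinate that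
tends to infinity, hence the criterion cannot be obtained from a single
sequence: each coordinate produces its own bound. *)
Lemma vanish_seqP F : (forall z : nat -> R * R,
    `|(z n).1| @[n --> \oo] --> +oo \/ `|(z n).2| @[n --> \oo] --> +oo ->
    F (z n) @[n --> \oo] --> (0 : R)) ->
  forall e : R, 0 < e -> exists M : R, forall v, M < euclid_norm v -> `|F v| < e.
Proof.
move=> seqF e e0.
have coord (pr : R * R -> R) : (forall z : nat -> R * R,
    `|pr (z n)| @[n --> \oo] --> +oo -> F (z n) @[n --> \oo] --> (0 : R)) ->
    exists2 M : R, 0 <= M & forall v, M < `|pr v| -> `|F v| < e.
  move=> prF; apply: contrapT => nM.
  have /choice[z zP] : forall n : nat, exists v, n%:R < `|pr v| /\ e <= `|F v|.
    move=> n; apply: contrapT => /forallNP nz; apply: nM.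
    exists n%:R => // v nv; have /not_andP[//|/negP] := nz v; by rewrite -ltNge.
  have zoo : `|pr (z n)| @[n --> \oo] --> +oo.
    apply/cvgryPge => A; near=> n; have [nz _] := zP n.
    rewrite (le_trans _ (ltW nz))//; near: n; exact: nbhs_infty_ger.
  have /cvgr0Pnorm_lt/(_ _ e0)[n _ /(_ n (leqnn n)) /=] := prF _ zoo.
  by have [_] := zP n; rewrite leNgt => /negbTE ->.
have [M1 M10 FM1] := coord fst (fun z zoo => seqF z (or_introl zoo)).
have [M2 M20 FM2] := coord snd (fun z zoo => seqF z (or_intror zoo)).
exists (M1 + M2) => v Mv.
have [/FM1//|v1] := ltP M1 `|v.1|; have [/FM2//|v2] := ltP M2 `|v.2|.
move: Mv; rewrite ltNge => /negP[]; exact: le_trans (euclid_norm_le v) (lerD v1 v2).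
Unshelve. all: by end_near. Qed.

Lemma C0D F u : C0 F -> C0 u -> C0 (fun v => F v + u v).
Proof.
move=> [cF F0] [cu u0]; split; first by move=> v; apply: cvgD; [exact: cF|exact: cu].
move=> e e0; have e20 : 0 < e / 2 by rewrite divr_gt0.
have [M1 FM] := F0 _ e20; have [M2 uM] := u0 _ e20.
exists (Num.max M1 M2) => v; rewrite gt_max => /andP[/FM ? /uM ?].
by rewrite (le_lt_trans (ler_normD _ _))// (splitr e) ltrD.
Qed.

Lemma C0M (B : R) F u : continuous u -> (forall v, `|u v| <= B) -> C0 F ->
  C0 (fun v => u v * F v).
Proof.
move=> cu uB [cF F0]; split; first by move=> v; apply: cvgM; [exact: cu|exact: cF].
move=> e e0; have B0 : 0 < `|B| + 1 by rewrite ltr_wpDl.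
have [M FM] := F0 _ (divr_gt0 e0 B0); exists M => v /FM.
rewrite ltr_pdivlMr// mulrC; apply: le_lt_trans.
by rewrite normrM ler_wpM2r// (le_trans (uB v))// (le_trans (ler_norm B))// lerDl.
Qed.

Lemma C0N F : C0 F -> C0 (fun v => - F v).
Proof.
move=> F0; rewrite (_ : (fun v => - F v) = (fun v => -1 * F v)).
  by apply: (@C0M 1) => // [|v]; [exact: cst_continuous|rewrite normrN1].
by apply/funext => v; rewrite mulN1r.
Qed.

Lemma C0Z (a : R) (F : R * R -> R) : C0 F -> C0 (fun w => a * F w).
Proof. by apply: (@C0M `|a|) => //; exact: cst_continuous. Qed.

Lemma C0B (F u : R * R -> R) : C0 F -> C0 u -> C0 (fun w => F w - u w).
Proof. by move=> F0 u0; apply: C0D => //; exact: C0N. Qed.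

End SequentialC0.

(** * Real two-sided transforms *)

Section PlanarOscillation.
Context {R : realType}.
Variable mu : R.
Local Notation leb := (@lebesgue_measure R).
Local Notation line := (measurableTypeR R).
Local Notation plane := (line * line)%type.

(** The only properties of [dunkl_cos] and [dunkl_sin] that the transform
uses. *)
Definition oscillating (X : R -> R) : Prop := [/\ continuous X,
  forall x, `|X x| <= 1 &
  forall (lam : nat -> R) (h : line -> R), `|lam n| @[n --> \oo] --> +oo ->
    L1 leb h -> weak_null leb (fun n x => X (lam n * x)) h].

Lemma oscillating_dunkl_cos : - 2^-1 <= mu -> oscillating (dunkl_cos mu).
Proof.
move=> mu_ge; split; [exact: dunkl_cos_continuous|exact: dunkl_cos_le1|].
by move=> lam h; exact: weak_null_dunkl_cos.
Qed.

Lemma oscillating_dunkl_sin : - 2^-1 <= mu -> oscillating (dunkl_sin mu).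
Proof.
move=> mu_ge; split; [exact: dunkl_sin_continuous|exact: dunkl_sin_le1|].
by move=> lam h; exact: weak_null_dunkl_sin.
Qed.

Variables (X Y : R -> R) (h : plane -> R).
Hypotheses (oX : oscillating X) (oY : oscillating Y).
Hypothesis hL : L1 (dunkl_measure mu) h.

Lemma Rintegral_dunkl (g : plane -> R) : L1 (dunkl_measure mu) g ->
  \int[dunkl_measure mu]_v g v = \int[lebesgue2 (R:=R)]_v (g v * dunkl_weight mu v).
Proof.
apply: Rintegral_density; first exact: measurable_dunkl_weight.
exact: dunkl_weight_ge0.
by [].
Qed.

Variables (s t : R).
Hypotheses (s0 : s != 0) (t0 : t != 0).

Let wave w (v : plane) := X (s * w.1 * v.1) * Y (t * w.2 * v.2).

Let wave_le w v : `|wave w v| <= 1.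
Proof. by case: oX oY => _ X1 _ [_ Y1 _]; rewrite normrM mulr_ile1. Qed.

Let mwave w : measurable_fun setT (wave w).
Proof.
case: oX oY => cX _ _ [cY _ _]; apply: measurable_funM.
  have mX : measurable_fun setT (fun x : line => X (s * w.1 * x)) by exact: measurable_dilate.
  exact: (measurableT_comp mX (@measurable_fst _ _ line line)).
have mY : measurable_fun setT (fun y : line => Y (t * w.2 * y)) by exact: measurable_dilate.
exact: (measurableT_comp mY (@measurable_snd _ _ line line)).
Qed.

Let mh : measurable_fun setT h.
Proof. exact/measurable_EFinP/measurable_int/hL. Qed.

Lemma L1_planar_wave (w : R * R) : L1 (dunkl_measure mu)
  (fun v => X (s * w.1 * v.1) * Y (t * w.2 * v.2) * h v).
Proof.
exact: (@L1_mul _ _ _ (dunkl_measure mu) (fun _ => wave w) 1 (fun=> mwave w)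
  (fun=> wave_le w) h 0%N hL).
Qed.

Definition planar_transform (w : R * R) : R :=
  \int[dunkl_measure mu]_v (X (s * w.1 * v.1) * Y (t * w.2 * v.2) * h v).

Lemma planar_transform_continuous : continuous planar_transform.
Proof.
apply: continuous_seqP => z p zp; case: oX oY => cX _ _ [cY _ _].
have [] // := @L1_dominated_cvg _ _ _ (dunkl_measure mu) (fun n v => wave (z n) v * h v)
  (fun v => wave p v * h v) (fun v => `|h v|).
- by move=> n; exact: measurable_funM.
- exact: integrable_norm.
- move=> v; apply: cvgMl.
  have z1 : (z n).1 @[n --> \oo] --> p.1 by apply: cvg_comp zp _; exact: cvg_fst.
  have z2 : (z n).2 @[n --> \oo] --> p.2 by apply: cvg_comp zp _; exact: cvg_snd.
  have Xz : s * (z n).1 * v.1 @[n --> \oo] --> s * p.1 * v.1.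
    by apply: cvgMl; exact: cvgMr.
  have Yz : t * (z n).2 * v.2 @[n --> \oo] --> t * p.2 * v.2.
    by apply: cvgMl; exact: cvgMr.
  by apply: cvgM; [exact: cvg_comp Xz (cX _)|exact: cvg_comp Yz (cY _)].
- by move=> n v; rewrite normrM ler_piMl.
Qed.

(** The weight of the Dunkl measure is absorbed in the test function, which
leaves the product of two Lebesgue measures.  One of the two factors tends to 0
and the other one stays bounded by the [L1] norm of its test function. *)
Lemma planar_transform_cvg0 (z : nat -> R * R) :
  `|(z n).1| @[n --> \oo] --> +oo \/ `|(z n).2| @[n --> \oo] --> +oo ->
  planar_transform (z n) @[n --> \oo] --> (0 : R).
Proof.
move=> zoo; case: oX oY => cX X1 X0 [cY Y1 Y0].
have scale_oo (r : R) (u : nat -> R) : r != 0 -> `|u n| @[n --> \oo] --> +oo ->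
    `|r * u n| @[n --> \oo] --> +oo.
  move=> r0 uoo; have r0' : 0 < `|r| by rewrite normr_gt0.
  apply/cvgryPge => A; move/cvgryPge/(_ (A / `|r|)) : uoo; apply: filterS => n.
  by rewrite normrM ler_pdivrMr// mulrC.
have bnd (phi : R -> R) lam (k : line -> R) : continuous phi ->
    (forall x, `|phi x| <= 1) -> L1 leb k ->
    `|\int[leb]_x (phi (lam * x) * k x)| <= \int[leb]_x `|k x|.
  move=> cphi phi1 kL.
  have pkL : L1 leb (fun x => phi (lam * x) * k x).
    exact: (@L1_mul _ line R leb (fun _ x => phi (lam * x)) 1
      (fun=> measurable_dilate lam cphi) (fun _ _ => phi1 _) _ 0%N kL).
  rewrite (le_trans (le_normr_Rintegral _ pkL))//.
  apply: le_Rintegral => //; try exact: integrable_norm.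
  by move=> x _; rewrite normrM ler_piMl.
have cvg0M (u v : nat -> R) B : (forall n, `|v n| <= B) ->
    u n @[n --> \oo] --> (0 : R) -> u n * v n @[n --> \oo] --> (0 : R).
  move=> vB u0; apply/cvgr0Pnorm_le => e e0.
  have B0 : 0 < `|B| + 1 by rewrite ltr_wpDl.
  have /cvgr0Pnorm_le/(_ _ (divr_gt0 e0 B0)) := u0; apply: filterS => n.
  rewrite ler_pdivlMr// normrM; apply: le_trans; rewrite ler_wpM2l//.
  by rewrite (le_trans (vB n))// (le_trans (ler_norm B))// lerDl.
have hwL : L1 (lebesgue2 (R:=R)) (fun v => h v * dunkl_weight mu v).
  apply: L1_density hL => //; first exact: measurable_dunkl_weight.
  exact: dunkl_weight_ge0.
have := @weak_null_tensor _ _ line line R leb leb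
  (fun n x => X (s * (z n).1 * x)) (fun n y => Y (t * (z n).2 * y))
  (fun n => measurable_dilate _ cX) (fun n => measurable_dilate _ cY)
  (fun n x => X1 _) (fun n x => Y1 _) _ _
  measurable_centered_itv measurable_centered_itv
  centered_itv_lty centered_itv_lty nd_centered_itv nd_centered_itv
  bigcup_centered_itv bigcup_centered_itv.
move=> /(_ _ _ hwL) tensor; have {tensor} := tensor _.
rewrite /weak_null /planar_transform => tensor.
rewrite (_ : (fun n => _) = (fun n => \int[lebesgue2 (R:=R)]_v
    (wave (z n) v * (h v * dunkl_weight mu v)))).
  apply: tensor => h1 h2 h1L h2L; case: zoo => zoo.
    by apply: cvg0M => [n|]; [exact: bnd|apply: X0 => //; exact: scale_oo].
  under eq_fun do rewrite mulrC.
  by apply: cvg0M => [n|]; [exact: bnd|apply: Y0 => //; exact: scale_oo].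
apply/funext => n; rewrite Rintegral_dunkl.
  by apply: eq_Rintegral => v _; rewrite mulrA.
exact: (@L1_mul _ _ _ (dunkl_measure mu) (fun n => wave (z n)) 1).
Qed.

Lemma planar_transform_C0 : C0 planar_transform.
Proof.
split; first exact: planar_transform_continuous.
exact: (vanish_seqP planar_transform_cvg0).
Qed.

End PlanarOscillation.

(** * Quaternions and their coordinates *)

Section QuaternionNorm.
Context {R : realType}.
Local Notation H := (quat R).
Implicit Types (p q : H) (x y : R).

Lemma qnormE p : `|p| = Num.sqrt (qre (p * qconj p)).
Proof. by []. Qed.

Lemma qnorm_sqr p : `|p| ^+ 2 = qre p ^+ 2 + qim_i p ^+ 2 + qim_j p ^+ 2 + qim_k p ^+ 2.
Proof. by rewrite qnormE sqr_sqrtr ?qre_mul_conj_ge0// qre_mul_conj. Qed.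

Lemma qnormM p q : `|p * q| = `|p| * `|q|.
Proof.
rewrite !qnormE -sqrtrM ?qre_mul_conj_ge0//; congr Num.sqrt.
by rewrite /=; ring.
Qed.

(** A predicate rather than four separate statements: most facts are proved once
for an arbitrary coordinate. *)
Variant qcoord : (H -> R) -> Prop :=
| qcoord_re : qcoord (@qre R)
| qcoord_i : qcoord (@qim_i R)
| qcoord_j : qcoord (@qim_j R)
| qcoord_k : qcoord (@qim_k R).

Lemma qcoordD c p q : qcoord c -> c (p + q) = c p + c q.
Proof. by case. Qed.

Lemma qcoordZ c x p : qcoord c -> c (x *: p) = x * c p.
Proof. by case. Qed.

Lemma qcoordB c p q : qcoord c -> c (p - q) = c p - c q.
Proof. by case. Qed.

Lemma qcoord_le c p : qcoord c -> `|c p| <= `|p|.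
Proof.
move=> cc; rewrite -ler_sqr ?nnegrE// qnorm_sqr real_normK ?num_real//.
have [a b] := (sqr_ge0 (qre p), sqr_ge0 (qim_i p)).
have [d e] := (sqr_ge0 (qim_j p), sqr_ge0 (qim_k p)).
by case: cc; lra.
Qed.

Lemma qnorm_le_sum p : `|p| <= `|qre p| + `|qim_i p| + `|qim_j p| + `|qim_k p|.
Proof.
rewrite -ler_sqr ?nnegrE ?addr_ge0// qnorm_sqr.
rewrite -(real_normK (num_real (qre p))) -(real_normK (num_real (qim_i p))).
rewrite -(real_normK (num_real (qim_j p))) -(real_normK (num_real (qim_k p))).
have [a b] := (normr_ge0 (qre p), normr_ge0 (qim_i p)).
have [d e] := (normr_ge0 (qim_j p), normr_ge0 (qim_k p)).
by nra.
Qed.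

Lemma nonexpansive_continuous (V : normedModType R) (c : V -> R) :
  (forall p r : V, `|c p - c r| <= `|p - r|) -> continuous c.
Proof.
move=> cle p; apply/cvgrPdist_lt => e e0; near=> r.
by apply: le_lt_trans (cle p r) _; near: r; exact: cvgr_dist_lt.
Unshelve. all: by end_near. Qed.

Lemma qcoord_continuous (c : H -> R) : qcoord c -> continuous (c : H -> R).
Proof.
move=> cc; apply: nonexpansive_continuous => p r.
by rewrite -qcoordB//; exact: qcoord_le.
Qed.

Lemma measurable_qcoord (c : H -> R) : qcoord c -> measurable_fun setT (c : H -> R).
Proof.
move=> cc; apply: (measurability _ (RGenOpens.measurableE R)).
move=> _ [_ [x [y ->]] <-]; rewrite setTI; apply: sub_sigma_algebra.
apply: open_comp; last exact: interval_open.
by move=> p _; exact: qcoord_continuous.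
Qed.

End QuaternionNorm.

(** * Quaternion-valued C0 functions *)

Section QuaternionC0.
Context {R : realType}.
Local Notation H := (quat R).
Implicit Types (Q : R * R -> H).

Definition qC0 Q : Prop := forall c, qcoord c -> C0 (fun w => c (Q w)).

Lemma in_C0_qcoord Q : qC0 Q -> in_C0 Q.
Proof.
move=> Q0.
have [[cr r0] [ci i0]] := (Q0 _ qcoord_re, Q0 _ qcoord_i).
have [[cj j0] [ck k0]] := (Q0 _ qcoord_j, Q0 _ qcoord_k).
have e4 (e : R) : 0 < e -> 0 < e / 4 by move=> ?; rewrite divr_gt0.
split.
  move=> p; apply/cvgrPdist_lt => e /e4 e40; near=> w.
  rewrite (le_lt_trans (qnorm_le_sum _))// !qcoordB//; try by constructor.
  have : `|qre (Q p) - qre (Q w)| < e / 4.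
    by near: w; have /cvgrPdist_lt := cr p; apply.
  have : `|qim_i (Q p) - qim_i (Q w)| < e / 4.
    by near: w; have /cvgrPdist_lt := ci p; apply.
  have : `|qim_j (Q p) - qim_j (Q w)| < e / 4.
    by near: w; have /cvgrPdist_lt := cj p; apply.
  have : `|qim_k (Q p) - qim_k (Q w)| < e / 4.
    by near: w; have /cvgrPdist_lt := ck p; apply.
  by move=> ? ? ? ?; lra.
move=> e /e4 e40.
have [M1 h1] := r0 _ e40; have [M2 h2] := i0 _ e40.
have [M3 h3] := j0 _ e40; have [M4 h4] := k0 _ e40.
exists (Num.max (Num.max M1 M2) (Num.max M3 M4)) => v.
rewrite !gt_max => /andP[/andP[/h1 ? /h2 ?] /andP[/h3 ? /h4 ?]].
by rewrite (le_lt_trans (qnorm_le_sum _))//; lra.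
Unshelve. all: by end_near. Qed.

Lemma qC0D P Q : qC0 P -> qC0 Q -> qC0 (fun w => P w + Q w).
Proof.
move=> P0 Q0 c cc; rewrite (_ : (fun w => _) = (fun w => c (P w) + c (Q w))).
  by apply: C0D; [exact: P0|exact: Q0].
by apply/funext => w; exact: qcoordD.
Qed.

Lemma qC0Z (B : R) (u : R * R -> R) Q : continuous u -> (forall w, `|u w| <= B) ->
  qC0 Q -> qC0 (fun w => u w *: Q w).
Proof.
move=> cu uB Q0 c cc; rewrite (_ : (fun w => _) = (fun w => u w * c (Q w))).
  by apply: (C0M cu uB); exact: Q0.
by apply/funext => w; exact: qcoordZ.
Qed.

Lemma qC0_mull (r : H) Q : qC0 Q -> qC0 (fun w => r * Q w).
Proof.
move=> Q0.
have [[cr ci] [cj ck]] := ((Q0 _ qcoord_re, Q0 _ qcoord_i),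
  (Q0 _ qcoord_j, Q0 _ qcoord_k)).
by move=> c [] /=; do ![apply: C0B|apply: C0D]; apply: C0Z.
Qed.

Lemma qC0_mulr (r : H) Q : qC0 Q -> qC0 (fun w => Q w * r).
Proof.
move=> Q0.
have [[cr ci] [cj ck]] := ((Q0 _ qcoord_re, Q0 _ qcoord_i),
  (Q0 _ qcoord_j, Q0 _ qcoord_k)).
have C0Zr (F : R * R -> R) (a : R) : C0 F -> C0 (fun w => F w * a).
  move=> /(C0Z a); rewrite (_ : (fun w => F w * a) = (fun w => a * F w))//.
  by apply/funext => w; rewrite mulrC.
by move=> c [] /=; do ![apply: C0B|apply: C0D]; apply: C0Zr.
Qed.

End QuaternionC0.

(** * Factorization of the kernel *)

Section QuaternionKernel.
Context {R : realType}.
Local Notation H := (quat R).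
Variables (q : H).
Hypothesis qij : q = qi \/ q = qj.
Implicit Types (x y s t : R).

(** The elements of the subfield [R + R q]. *)
Definition qlin x y : H := x%:A + y *: q.

Lemma qlinM x y s t : qlin x y * qlin s t = qlin (x * s - y * t) (x * t + y * s).
Proof. by rewrite /qlin; case: qij => ->; apply: quatP => /=; ring. Qed.

Lemma qlinC x y s t : qlin x y * qlin s t = qlin s t * qlin x y.
Proof. by rewrite !qlinM; congr qlin; ring. Qed.

Lemma qlin_norm_sqr x y : `|qlin x y| ^+ 2 = x ^+ 2 + y ^+ 2.
Proof. by rewrite qnorm_sqr /qlin; case: qij => -> /=; ring. Qed.

Lemma qcisE x : qcis q x = qlin (cos x) (sin x).
Proof. by []. Qed.

Lemma qcisD x y : qcis q (x + y) = qcis q x * qcis q y.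
Proof. by rewrite !qcisE qlinM cosD sinD; congr qlin; ring. Qed.

Lemma qcis0 : qcis q 0 = 1.
Proof. by rewrite /qcis cos0 sin0 scale1r scale0r addr0. Qed.

Lemma qcis_norm x : `|qcis q x| = 1.
Proof.
apply/eqP; rewrite -(@eqrXn2 _ 2)// expr1n qcisE qlin_norm_sqr cos2Dsin2.
by [].
Qed.

Lemma qcisV (r : R) x : r != 0 -> (r *: qcis q x)^-1 = r^-1 *: qcis q (- x).
Proof.
move=> r0.
have inv y (k : R) : k != 0 -> (k *: qcis q y) * (k^-1 *: qcis q (- y)) = 1.
  by move=> k0; rewrite -scalerAl -scalerAr scalerA divff// -qcisD subrr qcis0 scale1r.
have l := inv x r r0.
have rr : (r^-1 *: qcis q (- x)) * (r *: qcis q x) = 1.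
  by have := inv (- x) r^-1; rewrite invrK opprK invr_eq0; apply.
have u : r *: qcis q x \is a GRing.unit by apply/unitrP; exists (r^-1 *: qcis q (- x)).
by rewrite -[LHS]mulr1 -l mulKr.
Qed.

Variables (mu : R).
Hypothesis mu_ge : - 2^-1 <= mu.

Definition dunkl_wave x : H := qlin (dunkl_cos mu x) (dunkl_sin mu x).

Lemma dunkl_wave_le1 x : `|dunkl_wave x| <= 1.
Proof. by rewrite -(@expr_le1 _ 2)// qlin_norm_sqr dunkl_cos2Dsin2_le1. Qed.

(** The kernel is split into a phase that depends on [w] only, the Dunkl kernel
and a chirp that depends on [v] only; the phase includes that of
[(q b) ^ (mu + 1)]. *)
Lemma qqpdt_kernelE (a b c d e w v : R) : b != 0 ->
  qqpdt_kernel mu q a b c d e w v = (`|b| `^ (mu + 1))^-1 *: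
    (qcis q (- (Num.sg b * (mu + 1) * pi / 2) - (c * w ^+ 2 + e * w)) *
     dunkl_wave (- b^-1 * w * v) * qcis q (- (a * v ^+ 2 + d * v))).
Proof.
move=> b0; rewrite /qqpdt_kernel /qpow dunkl_EE//.
rewrite qcisV; last by rewrite gt_eqF// powR_gt0// normr_gt0.
rewrite -scalerAr -scalerAl; congr (_ *: _).
set phi := _ / 2; rewrite -/(qlin _ _) -/(dunkl_wave _).
have -> : - w / b * v = - b^-1 * w * v by field.
have -> : - (a * v ^+ 2 + c * w ^+ 2 + d * v + e * w) =
  - (c * w ^+ 2 + e * w) + - (a * v ^+ 2 + d * v) by ring.
by rewrite [in LHS]qcisD mulrA -(mulrA (dunkl_wave _)) -qcisD
  [dunkl_wave _ * _]qlinC.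
Qed.

End QuaternionKernel.

(** * Integration of quaternion-valued functions *)

Section QuaternionIntegration.
Context d (T : measurableType d) (R : realType).
Variable m : {measure set T -> \bar R}.
Local Notation H := (quat R).
Implicit Types (G P Q : T -> H) (r : H) (c : H -> R).

Definition qmeasurable G : Prop :=
  forall c, qcoord c -> measurable_fun setT (fun v => c (G v)).

Definition qL1 G : Prop := forall c, qcoord c -> L1 m (fun v => c (G v)).

Lemma qmeasurableM P Q : qmeasurable P -> qmeasurable Q ->
  qmeasurable (fun v => P v * Q v).
Proof.
move=> mP mQ.
have [[pr pi] [pj pk]] := ((mP _ qcoord_re, mP _ qcoord_i),
  (mP _ qcoord_j, mP _ qcoord_k)).
have [[tr ti] [tj tk]] := ((mQ _ qcoord_re, mQ _ qcoord_i),
  (mQ _ qcoord_j, mQ _ qcoord_k)).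
by move=> c [] /=; do ![apply: measurable_funB|apply: measurable_funD]; apply: measurable_funM.
Qed.

Lemma measurable_qnorm G : qmeasurable G -> measurable_fun setT (fun v => `|G v|).
Proof.
move=> mG; have [[pr pi] [pj pk]] := ((mG _ qcoord_re, mG _ qcoord_i),
  (mG _ qcoord_j, mG _ qcoord_k)).
rewrite (_ : (fun v => _) = (fun v => Num.sqrt (qre (G v) ^+ 2 +
    qim_i (G v) ^+ 2 + qim_j (G v) ^+ 2 + qim_k (G v) ^+ 2))).
  apply: measurableT_comp; first exact: continuous_measurable_fun (@sqrt_continuous R).
  by do ![apply: measurable_funD]; exact: measurable_funX.
by apply/funext => v; rewrite -qnorm_sqr sqrtr_sqr normr_id.
Qed.

Lemma qmeasurable_measurable G : measurable_fun setT G -> qmeasurable G.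
Proof. by move=> mG c cc; exact: (measurableT_comp (measurable_qcoord cc) mG). Qed.

Lemma qmeasurable_lin (x y : T -> R) (p q : H) : measurable_fun setT x ->
  measurable_fun setT y -> qmeasurable (fun v => x v *: p + y v *: q).
Proof.
move=> mx my c cc; rewrite (_ : (fun v => _) = (fun v => x v * c p + y v * c q)).
  by apply: measurable_funD; exact: measurable_funM.
by apply/funext => v; rewrite qcoordD// !qcoordZ.
Qed.

Lemma qmeasurable_cst (p : H) : qmeasurable (fun=> p).
Proof. by move=> c _; exact: measurable_cst. Qed.

Lemma qL1_norm G : qL1 G -> L1 m (fun v => `|G v|).
Proof.
move=> GL; have mG : qmeasurable G.
  by move=> c cc; exact/measurable_EFinP/measurable_int/GL.
have [[pr pi] [pj pk]] := ((GL _ qcoord_re, GL _ qcoord_i),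
  (GL _ qcoord_j, GL _ qcoord_k)).
apply: (@le_integrable _ _ _ _ _ measurableT _ (fun v =>
  (`|qre (G v)| + `|qim_i (G v)| + `|qim_j (G v)| + `|qim_k (G v)|)%:E)).
- by apply/measurable_EFinP; exact: measurable_qnorm.
- move=> v _; rewrite /= lee_fin normr_id (le_trans (qnorm_le_sum _))//; exact: ler_norm.
- by do ![apply: L1D]; exact: integrable_norm.
Qed.

Lemma norm_qL1 G : qmeasurable G -> L1 m (fun v => `|G v|) -> qL1 G.
Proof.
move=> mG GL c cc; apply: le_integrable GL => //; first exact/measurable_EFinP/mG.
by move=> v _; rewrite /= lee_fin normr_id qcoord_le.
Qed.

Lemma qcoord_qintegral c G : qcoord c -> c (qintegral m G) = \int[m]_v c (G v).
Proof. by case. Qed.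

Lemma Rintegral_lin4 (a1 a2 a3 a4 : R) (f1 f2 f3 f4 : T -> R) :
  L1 m f1 -> L1 m f2 -> L1 m f3 -> L1 m f4 ->
  \int[m]_v (a1 * f1 v + a2 * f2 v + a3 * f3 v + a4 * f4 v) =
  a1 * (\int[m]_v f1 v) + a2 * (\int[m]_v f2 v) +
  a3 * (\int[m]_v f3 v) + a4 * (\int[m]_v f4 v).
Proof.
move=> L_1 L_2 L_3 L_4.
have [[Z1 Z2] [Z3 Z4]] := ((L1Z a1 L_1, L1Z a2 L_2), (L1Z a3 L_3, L1Z a4 L_4)).
have D2 := L1D Z1 Z2; have D3 := L1D D2 Z3.
by rewrite !RintegralD// !RintegralZl.
Qed.

Lemma qintegral_mull r G : qL1 G ->
  qintegral m (fun v => r * G v) = r * qintegral m G.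
Proof.
move=> GL; have [[pr pi] [pj pk]] := ((GL _ qcoord_re, GL _ qcoord_i),
  (GL _ qcoord_j, GL _ qcoord_k)).
have lin4 a1 a2 a3 a4 := Rintegral_lin4 a1 a2 a3 a4 pr pi pj pk.
apply: quatP => /=.
- transitivity (\int[m]_v (qre r * qre (G v) + - qim_i r * qim_i (G v)
    + - qim_j r * qim_j (G v) + - qim_k r * qim_k (G v))).
    by apply: eq_Rintegral => v _; ring.
  by rewrite lin4; ring.
- transitivity (\int[m]_v (qim_i r * qre (G v) + qre r * qim_i (G v)
    + - qim_k r * qim_j (G v) + qim_j r * qim_k (G v))).
    by apply: eq_Rintegral => v _; ring.
  by rewrite lin4; ring.
- transitivity (\int[m]_v (qim_j r * qre (G v) + qim_k r * qim_i (G v)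
    + qre r * qim_j (G v) + - qim_i r * qim_k (G v))).
    by apply: eq_Rintegral => v _; ring.
  by rewrite lin4; ring.
- transitivity (\int[m]_v (qim_k r * qre (G v) + - qim_j r * qim_i (G v)
    + qim_i r * qim_j (G v) + qre r * qim_k (G v))).
    by apply: eq_Rintegral => v _; ring.
  by rewrite lin4; ring.
Qed.

Lemma qintegral_mulr r G : qL1 G ->
  qintegral m (fun v => G v * r) = qintegral m G * r.
Proof.
move=> GL; have [[pr pi] [pj pk]] := ((GL _ qcoord_re, GL _ qcoord_i),
  (GL _ qcoord_j, GL _ qcoord_k)).
have lin4 a1 a2 a3 a4 := Rintegral_lin4 a1 a2 a3 a4 pr pi pj pk.
apply: quatP => /=.
- transitivity (\int[m]_v (qre r * qre (G v) + - qim_i r * qim_i (G v)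
    + - qim_j r * qim_j (G v) + - qim_k r * qim_k (G v))).
    by apply: eq_Rintegral => v _; ring.
  by rewrite lin4; ring.
- transitivity (\int[m]_v (qim_i r * qre (G v) + qre r * qim_i (G v)
    + qim_k r * qim_j (G v) + - qim_j r * qim_k (G v))).
    by apply: eq_Rintegral => v _; ring.
  by rewrite lin4; ring.
- transitivity (\int[m]_v (qim_j r * qre (G v) + - qim_k r * qim_i (G v)
    + qre r * qim_j (G v) + qim_i r * qim_k (G v))).
    by apply: eq_Rintegral => v _; ring.
  by rewrite lin4; ring.
- transitivity (\int[m]_v (qim_k r * qre (G v) + qim_j r * qim_i (G v)
    + - qim_i r * qim_j (G v) + qre r * qim_k (G v))).
    by apply: eq_Rintegral => v _; ring.
  by rewrite lin4; ring.
Qed.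

(** With [I] the integral, [|I| ^ 2] is the integral of the scalar product of [I]
and [G v], that is of the real part of [I * qconj (G v)], which is at most
[|I| |G v|]. *)
Lemma norm_qintegral_le G : qL1 G -> `|qintegral m G| <= \int[m]_v `|G v|.
Proof.
move=> GL; have [[pr pi] [pj pk]] := ((GL _ qcoord_re, GL _ qcoord_i),
  (GL _ qcoord_j, GL _ qcoord_k)).
set I := qintegral m G.
have [I0|I0] := eqVneq `|I| 0.
  by rewrite I0; apply: Rintegral_ge0.
have Ipos : 0 < `|I| by rewrite lt_def I0 normr_ge0.
rewrite -(ler_pM2l Ipos) -expr2 qnorm_sqr -RintegralZl//; last exact: qL1_norm.
rewrite !expr2 [X in X <= _](_ : _ = \int[m]_v (qre I * qre (G v) +
    qim_i I * qim_i (G v) + qim_j I * qim_j (G v) + qim_k I * qim_k (G v))); last first.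
  by rewrite Rintegral_lin4.
apply: le_Rintegral => //.
- by do ![apply: L1D]; apply: L1Z.
- by apply: L1Z; exact: qL1_norm.
- move=> v _.
  have -> : qre I * qre (G v) + qim_i I * qim_i (G v) + qim_j I * qim_j (G v)
      + qim_k I * qim_k (G v) = qre (I * qconj (G v)) by rewrite /=; ring.
  rewrite (le_trans (ler_norm _))// (le_trans (qcoord_le _ qcoord_re))// qnormM.
  suff -> : `|qconj (G v)| = `|G v| by [].
  by apply/eqP; rewrite -(@eqrXn2 _ 2)// !qnorm_sqr /= !sqrrN.
Qed.

End QuaternionIntegration.

(** * The two-sided quaternion Dunkl transform *)

Section QQPDT.
Context {R : realType}.
Local Notation H := (quat R).
Local Notation plane := (measurableTypeR R * measurableTypeR R)%type.

Lemma qC0_qcisl (q : H) (A : R * R -> R) (Q : R * R -> H) : continuous A ->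
  qC0 Q -> qC0 (fun w => qcis q (A w) * Q w).
Proof.
move=> cA Q0.
rewrite (_ : (fun w => _) = (fun w => cos (A w) *: Q w + sin (A w) *: (q * Q w))).
  apply: qC0D.
    apply: (@qC0Z _ 1) => // [w|w]; last exact: cos_max.
    by apply: continuous_comp; [exact: cA|exact: continuous_cos].
  apply: (@qC0Z _ 1) => // [w|w|]; last exact: qC0_mull.
    by apply: continuous_comp; [exact: cA|exact: continuous_sin].
  exact: sin_max.
by apply/funext => w; rewrite /qcis mulrDl mulr_algl -scalerAl.
Qed.

Lemma qC0_qcisr (q : H) (A : R * R -> R) (Q : R * R -> H) : continuous A ->
  qC0 Q -> qC0 (fun w => Q w * qcis q (A w)).
Proof.
move=> cA Q0.
rewrite (_ : (fun w => _) = (fun w => cos (A w) *: Q w + sin (A w) *: (Q w * q))).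
  apply: qC0D.
    apply: (@qC0Z _ 1) => // [w|w]; last exact: cos_max.
    by apply: continuous_comp; [exact: cA|exact: continuous_cos].
  apply: (@qC0Z _ 1) => // [w|w|]; last exact: qC0_mulr.
    by apply: continuous_comp; [exact: cA|exact: continuous_sin].
  exact: sin_max.
by apply/funext => w; rewrite /qcis mulrDr mulr_algr -scalerAr.
Qed.

Variables (mu : R) (mu_ge : - 2^-1 <= mu) (g : plane -> H).
Hypothesis gL : qL1 (dunkl_measure mu) g.
Variables (s t : R) (s0 : s != 0) (t0 : t != 0).

Let waves (w : R * R) (v : plane) : H :=
  dunkl_wave qi mu (s * w.1 * v.1) * g v * dunkl_wave qj mu (t * w.2 * v.2).

Definition dunkl_transform (w : R * R) : H := qintegral (dunkl_measure mu) (waves w).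

Let mg : qmeasurable g.
Proof. by move=> c cc; exact/measurable_EFinP/measurable_int/(gL cc). Qed.

Let measurable_wave (X : R -> R) (r : R) (pr : plane -> measurableTypeR R) :
  continuous X -> measurable_fun setT pr -> measurable_fun setT (fun v => X (r * pr v)).
Proof.
move=> cX mpr.
have mX : measurable_fun setT (fun x : measurableTypeR R => X (r * x)).
  exact: measurable_dilate.
exact: (measurableT_comp mX mpr).
Qed.

Let mwaves w : qmeasurable (waves w).
Proof.
have cosC := dunkl_cos_continuous mu_ge; have sinC := dunkl_sin_continuous mu_ge.
apply: qmeasurableM; first apply: qmeasurableM => //; apply: qmeasurable_lin;
  apply: measurable_wave => //; (exact: measurable_fst || exact: measurable_snd).
Qed.

Let waves_le w v : `|waves w v| <= `|g v|.
Proof.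
rewrite /waves !qnormM.
have e1 := @dunkl_wave_le1 R qi (or_introl erefl) mu mu_ge (s * w.1 * v.1).
have e2 := @dunkl_wave_le1 R qj (or_intror erefl) mu mu_ge (t * w.2 * v.2).
by rewrite mulrAC ler_piMl// mulr_ile1.
Qed.

Lemma wavesL w : qL1 (dunkl_measure mu) (waves w).
Proof.
apply: norm_qL1; first exact: mwaves.
apply: le_integrable (qL1_norm gL) => //.
  by apply/measurable_EFinP; exact: measurable_qnorm (mwaves w).
by move=> v _; rewrite /= lee_fin !normr_id waves_le.
Qed.

Lemma norm_dunkl_transform_le w :
  `|dunkl_transform w| <= \int[dunkl_measure mu]_v `|g v|.
Proof.
apply: le_trans (norm_qintegral_le (wavesL w)) _.
apply: le_Rintegral => //; [exact: qL1_norm (wavesL w)|exact: qL1_norm].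
Qed.

Lemma qL1_mull (r : H) (G : plane -> H) :
  qL1 (dunkl_measure mu) G -> qL1 (dunkl_measure mu) (fun v => r * G v).
Proof.
move=> GL; apply: norm_qL1.
  apply: qmeasurableM; first exact: qmeasurable_cst.
  by move=> c cc; exact/measurable_EFinP/measurable_int/(GL c cc).
by under eq_fun do rewrite qnormM; apply: L1Z; exact: qL1_norm.
Qed.

Lemma qL1_mulr (r : H) (G : plane -> H) :
  qL1 (dunkl_measure mu) G -> qL1 (dunkl_measure mu) (fun v => G v * r).
Proof.
move=> GL; apply: norm_qL1.
  apply: qmeasurableM; last exact: qmeasurable_cst.
  by move=> c cc; exact/measurable_EFinP/measurable_int/(GL c cc).
by under eq_fun do rewrite qnormM mulrC; apply: L1Z; exact: qL1_norm.
Qed.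

(** Expanding both kernels along [1, qi] and [1, qj] turns each coordinate of the
transform into a sum of four real transforms, applied to coordinates of [g],
[qi * g], [g * qj] and [qi * g * qj]. *)
Lemma dunkl_transform_qC0 : qC0 dunkl_transform.
Proof.
move=> c cc.
have L1g := gL cc; have L2g := qL1_mull qi gL cc.
have L3g := qL1_mulr qj gL cc; have L4g := qL1_mulr qj (qL1_mull qi gL) cc.
have oC := oscillating_dunkl_cos mu_ge; have oS := oscillating_dunkl_sin mu_ge.
pose I X Y h := @planar_transform R mu X Y h s t.
rewrite (_ : (fun w => _) = (fun w =>
     I (dunkl_cos mu) (dunkl_cos mu) (fun v => c (g v)) w
   + I (dunkl_sin mu) (dunkl_cos mu) (fun v => c (qi * g v)) w
   + I (dunkl_cos mu) (dunkl_sin mu) (fun v => c (g v * qj)) w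
   + I (dunkl_sin mu) (dunkl_sin mu) (fun v => c (qi * g v * qj)) w)).
  by do ![apply: C0D]; exact: planar_transform_C0.
apply/funext => w; rewrite qcoord_qintegral//.
have expand v : c (waves w v) =
    1 * (dunkl_cos mu (s * w.1 * v.1) * dunkl_cos mu (t * w.2 * v.2) * c (g v))
  + 1 * (dunkl_sin mu (s * w.1 * v.1) * dunkl_cos mu (t * w.2 * v.2) * c (qi * g v))
  + 1 * (dunkl_cos mu (s * w.1 * v.1) * dunkl_sin mu (t * w.2 * v.2) * c (g v * qj))
  + 1 * (dunkl_sin mu (s * w.1 * v.1) * dunkl_sin mu (t * w.2 * v.2) * c (qi * g v * qj)).
  rewrite !mul1r -!qcoordZ// -!qcoordD//; congr c.
  by rewrite /waves /dunkl_wave /qlin; apply: quatP => /=; ring.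
under eq_Rintegral do rewrite expand.
by rewrite Rintegral_lin4 ?mul1r//; exact: L1_planar_wave.
Qed.

End QQPDT.

(** * The quadratic-phase transform *)

Section MainProof.
Context {R : realType}.
Local Notation H := (quat R).
Local Notation plane := (measurableTypeR R * measurableTypeR R)%type.
Variables (mu : R) (a b c d e : R * R) (f : plane -> H).
Hypotheses (mu_ge : - 2^-1 <= mu) (b1 : b.1 != 0) (b2 : b.2 != 0) (hf : in_L1 mu f).

Definition chirped (v : plane) : H :=
  qcis qi (- (a.1 * v.1 ^+ 2 + d.1 * v.1)) * f v *
  qcis qj (- (a.2 * v.2 ^+ 2 + d.2 * v.2)).

Lemma norm_chirped v : `|chirped v| = `|f v|.
Proof.
rewrite /chirped !qnormM (qcis_norm (or_introl erefl)) (qcis_norm (or_intror erefl)).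
by rewrite mul1r mulr1.
Qed.

Lemma L1_norm_in_L1 : L1 (dunkl_measure mu) (fun v => `|f v|).
Proof.
case: hf => mf foo; apply/integrableP; split.
  by apply/measurable_EFinP/measurable_qnorm; exact: qmeasurable_measurable.
apply: le_lt_trans foo; rewrite le_eqVlt; apply/orP; left; apply/eqP.
by apply: eq_integral => v _; rewrite /= normr_id.
Qed.

Lemma qL1_chirped : qL1 (dunkl_measure mu) chirped.
Proof.
apply: norm_qL1; last by under eq_fun do rewrite norm_chirped; exact: L1_norm_in_L1.
have mchirp (q : H) (x y : R) (pr : plane -> measurableTypeR R) :
    measurable_fun setT pr -> qmeasurable (fun v => qcis q (- (x * pr v ^+ 2 + y * pr v))).
  move=> mpr.
  have mA : measurable_fun setT (fun v => - (x * pr v ^+ 2 + y * pr v) : R).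
    apply: measurableT_comp => //; apply: measurable_funD; apply: measurable_funM => //.
    exact: measurable_funX.
  apply: qmeasurable_lin.
    exact: (measurableT_comp (continuous_measurable_fun (@continuous_cos R)) mA).
  exact: (measurableT_comp (continuous_measurable_fun (@continuous_sin R)) mA).
apply: qmeasurableM; first apply: qmeasurableM.
- by apply: mchirp; exact: measurable_fst.
- by apply: qmeasurable_measurable; case: hf.
- by apply: mchirp; exact: measurable_snd.
Qed.

Let s := - b.1^-1.
Let t := - b.2^-1.
Let s0 : s != 0. Proof. by rewrite oppr_eq0 invr_eq0. Qed.
Let t0 : t != 0. Proof. by rewrite oppr_eq0 invr_eq0. Qed.

Definition outer_phase (x y z u : R) : R :=
  - (Num.sg x * (mu + 1) * pi / 2) - (y * u ^+ 2 + z * u).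

(** The second kernel has to be reversed, so that its chirp meets [f] and its
phase comes out on the right; this is where commutativity of [R + R qj] is
used. *)
Lemma qqpdtE w : qqpdt mu a b c d e f w =
  (dunkl_const mu ^+ 2 / `|b.1 * b.2| `^ (mu + 1)) *:
  (qcis qi (outer_phase b.1 c.1 e.1 w.1) * dunkl_transform mu chirped s t w *
   qcis qj (outer_phase b.2 c.2 e.2 w.2)).
Proof.
rewrite /qqpdt -scalerA; congr (_ *: _).
rewrite normrM powRM// invfM.
set k1 := (_ `^ _)^-1; set k2 := (_ `^ _)^-1.
set p := qcis qi _; set q := qcis qj _.
have wL := wavesL mu_ge qL1_chirped s t w.
transitivity (qintegral (dunkl_measure mu) (fun v => (((k1 * k2) *: p) *
    (dunkl_wave qi mu (s * w.1 * v.1) * chirped v *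
     dunkl_wave qj mu (t * w.2 * v.2))) * q)).
  congr (qintegral _ _); apply/funext => v.
  rewrite (qqpdt_kernelE (or_introl erefl))// (qqpdt_kernelE (or_intror erefl))//.
  rewrite -/k1 -/k2 -/p -/q -/s -/t.
  set E1 := dunkl_wave qi mu _; set E2 := dunkl_wave qj mu _.
  rewrite /chirped; set B1 := qcis qi _; set B2 := qcis qj _.
  have comm : q * E2 * B2 = B2 * E2 * q.
    have [c1 c2 c3] : [/\ E2 * B2 = B2 * E2, q * B2 = B2 * q & q * E2 = E2 * q].
      by split; apply: qlinC; right.
    by rewrite -mulrA c1 mulrA c2 -mulrA c3 mulrA.
  rewrite comm -!scalerAl -!scalerAr scalerA; congr (_ *: _).
  by rewrite !mulrA.
rewrite qintegral_mulr; last exact: qL1_mull.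
by rewrite qintegral_mull// -!scalerAl.
Qed.

Lemma continuous_outer_phase (x y z : R) (pr : R * R -> R) : continuous pr ->
  continuous (fun w => outer_phase x y z (pr w)).
Proof.
move=> cpr w; apply: cvgB; first exact: cvg_cst.
apply: cvgD; apply: cvgMr; last exact: cpr.
exact: cvg_comp (cpr w) (@exprn_continuous _ 2 _).
Qed.

Lemma qqpdt_in_C0 : in_C0 (qqpdt mu a b c d e f).
Proof.
apply: in_C0_qcoord; rewrite (funext qqpdtE).
apply: (@qC0Z _ `|dunkl_const mu ^+ 2 / `|b.1 * b.2| `^ (mu + 1)|) => //.
  exact: cst_continuous.
apply: qC0_qcisr; first by apply: continuous_outer_phase => w; exact: cvg_snd.
apply: qC0_qcisl; first by apply: continuous_outer_phase => w; exact: cvg_fst.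
have Q0 := dunkl_transform_qC0 mu_ge qL1_chirped s0 t0.
exact: Q0.
Qed.

Lemma norm_qqpdt_le w : ((`|qqpdt mu a b c d e f w|)%:E <=
  (dunkl_const mu ^+ 2 / `|b.1 * b.2| `^ (mu + 1))%:E * L1norm mu f)%E.
Proof.
have <- : (\int[dunkl_measure mu]_v `|f v|)%:E = L1norm mu f.
  rewrite /Rintegral fineK//; exact: integrable_fin_num L1_norm_in_L1.
have C0 : 0 <= dunkl_const mu ^+ 2 / `|b.1 * b.2| `^ (mu + 1).
  by apply: mulr_ge0; rewrite ?invr_ge0 ?powR_ge0 ?sqr_ge0.
rewrite -EFinM lee_fin qqpdtE normrZ ger0_norm// ler_wpM2l//.
rewrite !qnormM (qcis_norm (or_introl erefl)) (qcis_norm (or_intror erefl)) mul1r mulr1.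
apply: le_trans (norm_dunkl_transform_le mu_ge qL1_chirped s t w) _.
by under eq_Rintegral do rewrite norm_chirped.
Qed.

End MainProof.

Unset Implicit Arguments.

Theorem proposition3p2 (R : realType) (mu : R) (hmu : - 2^-1 <= mu)
    (a b c d e : R * R) (hb1 : b.1 != 0) (hb2 : b.2 != 0)
    (f : measurableTypeR R * measurableTypeR R -> quat R)
    (hf : in_L1 mu f) :
  in_C0 (qqpdt mu a b c d e f) /\
  (Linfnorm mu (qqpdt mu a b c d e f) <=
     (dunkl_const mu ^+ 2 / `|b.1 * b.2| `^ (mu + 1))%:E * L1norm mu f)%E.
Proof.
split; first exact: qqpdt_in_C0.
by apply/ess_supP; apply: aeW => w; exact: norm_qqpdt_le.
Qed.
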